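(* Consider the germ at $0$ of a rigid hypersurface $\{\mathrm{Re}\,z_3=F(z_1,\bar z_1,z_2,\bar z_2)\}$ in $\mathbb{C}^3$ in the class $\mathfrak{C}_{2,1}$, whose graphing function $F$ satisfies: (a) $S_1=0$ and $S_{\bar 1}=0$, where $S:=\left(F_{1\bar 2}/F_{1\bar 1}\right)_1$; (b) $F=r(z_2,\bar z_2)|z_1|^2+t(z_2,\bar z_2)z_1^2+\overline{t(z_2,\bar z_2)}\,\bar z_1^2$ for some smooth functions $r$ (real-valued) and $t$ (complex-valued) of $z_2$; (c) $t_{\bar 2}=\dfrac{r^2}{2}$; (d) $r(z_2,\bar z_2)=R(z_2+\bar z_2)$ for some smooth positive function $R(x)$ of one real variable defined near the origin. Then this germ is rigidly equivalent to the germ at $0$ of one of the following: (i) the tube hypersurface given by an equation of the form $$\mathrm{Re}\,z_3=\frac{(z_1+\bar z_1)^2}{z_2+\bar z_2+D},\quad D>0;$$ (ii) the hypersurface given by an equation of the form $$\mathrm{Re}\,z_3=\frac{z_1^2+2\sqrt{D}\,|z_1|^2|z_2+1|^2+\bar z_1^2}{1-D|z_2+1|^4},\quad 0<D<1;$$ (iii) the hypersurface given by an equation of the form $$\mathrm{Re}\,z_3=\frac{i\left(e^{iD}(z_2+1)^2-e^{-iD}(\bar z_2+1)^2\right)(z_1^2+\bar z_1^2)-4|z_1|^2|z_2+1|^2}{e^{iD}(z_2+1)^2+e^{-iD}(\bar z_2+1)^2},\quad 0<D<\pi/2.$$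
   Context: Subscripts $1,\bar 1,2,\bar 2$ denote partial (Wirtinger) derivatives with respect to $z_1,\bar z_1,z_2,\bar z_2$. A rigid hypersurface in $\mathbb{C}^3$ is a hypersurface given by an equation $\mathrm{Re}\,z_3=F(z_1,\bar z_1,z_2,\bar z_2)$, where $F$ (the graphing function) is a smooth real-valued function; here $F$ is defined near the origin of $\mathbb{C}^2$ with $F(0)=0$, and its domain is allowed to shrink. The class $\mathfrak{C}_{2,1}$ consists of the connected 5-dimensional CR-hypersurfaces that are 2-nondegenerate and uniformly Levi degenerate of rank 1 (the Levi form has rank exactly 1 at every point). For a rigid hypersurface with $F_{1\bar 1}>0$ everywhere, membership in $\mathfrak{C}_{2,1}$ means that $F_{1\bar 1}F_{2\bar 2}-|F_{1\bar 2}|^2=0$ everywhere and that $S:=(F_{1\bar 2}/F_{1\bar 1})_1$ vanishes nowhere. Two germs of rigid hypersurfaces at $0$ are called rigidly equivalent if there exists a map of the form $$(z_1,z_2,z_3)\mapsto\bigl(f(z_1,z_2),\,g(z_1,z_2),\,a z_3+h(z_1,z_2)\bigr),\quad a\in\mathbb{R}\setminus\{0\},$$ nondegenerate at the origin (invertible differential at $0$), where $f,g,h$ are holomorphic near $0$ with $f(0)=g(0)=h(0)=0$, that maps one hypersurface germ into the other. *)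

(* Defs.v *)
From Stdlib Require Import Reals.
From Coquelicot Require Import Coquelicot.

Local Open Scope C_scope.

(* C^2 as a real normed space (for smoothness), and C^2, C^3 as complex normed
   spaces (for holomorphy). *)
Definition C2R : NormedModule R_AbsRing :=
  prod_NormedModule R_AbsRing C_R_NormedModule C_R_NormedModule.
Definition C2 : NormedModule C_AbsRing :=
  prod_NormedModule C_AbsRing C_NormedModule C_NormedModule.
Definition C3 : NormedModule C_AbsRing :=
  prod_NormedModule C_AbsRing C2 C_NormedModule.

Definition origin2 : C * C := (RtoC 0, RtoC 0).
Definition origin3 : C * C * C := (origin2, RtoC 0).

(* A property holding on a neighbourhood of the origin of C^2. *)
Definition near0 (P : C -> C -> Prop) : Prop :=
  locally (origin2 : C2R) (fun p => P (fst p) (snd p)).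

(* All iterated directional derivatives of order <= n exist and are continuous
   on U.  On R, C and C^2, the only spaces on which this is used, this is the
   class C^n. *)
Fixpoint Ck_on {V : NormedModule R_AbsRing} (n : nat) (U : V -> Prop)
    (f : V -> R) {struct n} : Prop :=
  (forall p, U p -> continuous f p) /\
  match n with
  | O => True
  | S m => forall v : V,
      (forall p, U p -> ex_derive (fun s : R => f (plus p (scal s v))) 0%R) /\
      Ck_on m U (fun p => Derive (fun s : R => f (plus p (scal s v))) 0%R)
  end.

Definition smooth_near {V : NormedModule R_AbsRing} (f : V -> R) (p : V) : Prop :=
  exists U : V -> Prop, open U /\ U p /\ forall n, Ck_on n U f.

(* Real directional derivative of g : C -> C at z along v. *)
Definition Cdir (v : C) (g : C -> C) (z : C) : C :=
  (Derive (fun s : R => Re (g (z + RtoC s * v))) 0%R,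
   Derive (fun s : R => Im (g (z + RtoC s * v))) 0%R).

Definition wirt (g : C -> C) (z : C) : C := (Cdir 1 g z - Ci * Cdir Ci g z) / 2.
Definition wirtb (g : C -> C) (z : C) : C := (Cdir 1 g z + Ci * Cdir Ci g z) / 2.

(* The subscripts 1, \bar 1, 2, \bar 2. *)
Definition dz1 (F : C -> C -> C) : C -> C -> C :=
  fun z1 z2 => wirt (fun w => F w z2) z1.
Definition dz1b (F : C -> C -> C) : C -> C -> C :=
  fun z1 z2 => wirtb (fun w => F w z2) z1.
Definition dz2 (F : C -> C -> C) : C -> C -> C :=
  fun z1 z2 => wirt (fun w => F z1 w) z2.
Definition dz2b (F : C -> C -> C) : C -> C -> C :=
  fun z1 z2 => wirtb (fun w => F z1 w) z2.

Definition Sfun (F : C -> C -> C) : C -> C -> C :=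
  dz1 (fun z1 z2 => dz2b (dz1 F) z1 z2 / dz1b (dz1 F) z1 z2).

Definition embed (F : C -> C -> R) : C -> C -> C := fun z1 z2 => RtoC (F z1 z2).

(* F is the graphing function of the germ at 0 of a rigid hypersurface. *)
Definition graphing_germ (F : C -> C -> R) : Prop :=
  smooth_near (V := C2R) (fun p => F (fst p) (snd p)) origin2 /\ F 0 0 = 0%R.

(* Membership in C_{2,1} of the germ with graphing function F, in the case
   F_{1\bar 1} > 0 (F being real-valued, F_{1\bar 1} is real). *)
Definition in_class_C21 (F : C -> C -> R) : Prop :=
  near0 (fun z1 z2 =>
    let G := embed F in
    (0 < Re (dz1b (dz1 G) z1 z2))%R /\
    dz1b (dz1 G) z1 z2 * dz2b (dz2 G) z1 z2
      - RtoC (Cmod (dz2b (dz1 G) z1 z2) ^ 2)%R = 0 /\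
    Sfun G z1 z2 <> 0).

(* The set Re z_3 = F(z_1, z_2).  The right-hand side is complex-typed so that
   equations whose real-valued right-hand side is written with complex
   operations can be stated verbatim. *)
Definition rigid_hypersurface (F : C -> C -> C) (z : C3) : Prop :=
  RtoC (Re (snd z)) = F (fst (fst z)) (snd (fst z)).

Definition holomorphic_near0 (f : C -> C -> C) : Prop :=
  locally (origin2 : C2) (fun p =>
    ex_filterdiff (K := C_AbsRing) (U := C2) (V := C_NormedModule)
      (fun q => f (fst q) (snd q)) (locally p)).

Definition rigid_map (f g h : C -> C -> C) (a : R) (z : C3) : C3 :=
  let z1 := fst (fst z) in let z2 := snd (fst z) in let z3 := snd z in
  ((f z1 z2, g z1 z2), RtoC a * z3 + h z1 z2).

Definition nondegenerate_at (Phi : C3 -> C3) (p : C3) : Prop :=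
  exists L M : C3 -> C3,
    filterdiff Phi (locally p) L /\
    (forall v, M (L v) = v) /\ (forall v, L (M v) = v).

Definition rigidly_equivalent (F G : C -> C -> C) : Prop :=
  exists (f g h : C -> C -> C) (a : R),
    holomorphic_near0 f /\ holomorphic_near0 g /\ holomorphic_near0 h /\
    f 0 0 = 0 /\ g 0 0 = 0 /\ h 0 0 = 0 /\ a <> 0%R /\
    nondegenerate_at (rigid_map f g h a) origin3 /\
    locally (origin3 : C3) (fun z =>
      rigid_hypersurface F z -> rigid_hypersurface G (rigid_map f g h a z)).

(* e^{i theta} *)
Definition cis (theta : R) : C := (cos theta, sin theta).

Definition model_i (D : R) : C -> C -> C := fun z1 z2 =>
  (z1 + Cconj z1) ^ 2 / (z2 + Cconj z2 + RtoC D).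

Definition model_ii (D : R) : C -> C -> C := fun z1 z2 =>
  (z1 ^ 2
   + 2 * RtoC (sqrt D) * RtoC (Cmod z1 ^ 2)%R * RtoC (Cmod (z2 + 1) ^ 2)%R
   + Cconj z1 ^ 2)
  / (1 - RtoC D * RtoC (Cmod (z2 + 1) ^ 4)%R).

Definition model_iii (D : R) : C -> C -> C := fun z1 z2 =>
  (Ci * (cis D * (z2 + 1) ^ 2 - cis (- D) * (Cconj z2 + 1) ^ 2)
      * (z1 ^ 2 + Cconj z1 ^ 2)
   - 4 * RtoC (Cmod z1 ^ 2)%R * RtoC (Cmod (z2 + 1) ^ 2)%R)
  / (cis D * (z2 + 1) ^ 2 + cis (- D) * (Cconj z2 + 1) ^ 2).

(* Main.v *)
Require Import Defs.
From Stdlib Require Import Reals Lra Nsatz.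
From Coquelicot Require Import Coquelicot.

(** Write R for the profile of r and y := 1/R, a function of x = z2 + conj z2.

    The determinant of the Levi form of r |z1|^2 + 2 Re (t z1^2) is a quadratic
    polynomial in z1 and conj z1.  Its coefficient at |z1|^2, together with
    t_{\bar 2} = r^2/2, gives R R'' = R'^2 + R^4 ([levi_ode]): the metric
    R |dz2| has constant curvature -4.  In terms of y this reads
    y'^2 - y y'' = 1, so that c := (y'^2 - 1)/y^2 is constant and y'' = c y
    ([reciprocal_ode]).

    Metrics of the same constant curvature are locally isometric, by a
    holomorphic map W that may be normalized by W(0) = 0.  Taking the half-plane
    metric |dW|/(W + conj W + 1) as target, the map
    (z1, z2) |-> (const * z1 sqrt(W'), W) carries the mixed term of the tube
    (z1 + conj z1)^2/(z2 + conj z2 + 1) to r |z1|^2.  The square terms then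
    agree as well: t_{\bar 2} = r^2/2 determines t up to a holomorphic
    function phi(z2), and 2 Re (phi z1^2) is the real part of a holomorphic
    function, which is absorbed in z3.  Hence every germ under consideration is
    rigidly equivalent to the tube (i) with D = 1, whatever the sign of c.

    The isometry is explicit.  Let S and K be the holomorphic functions with
    S' = K, K' = c S, S(0) = 0, K(0) = 1, and put M := y(0) K + (y'(0) - 1) S and
    W := S/M.  The Wronskian of S and M is constant, so W' = y(0)/M^2 and
    sqrt(W') is a multiple of 1/M without any choice of branch.  The two
    identities

      |M + S|^2 - |S|^2 = y(0) y(z2 + conj z2),
      conj M = M y'(z2 + conj z2) - M' y(z2 + conj z2)

    ([isometry_identities]) say that W is an isometry and that the coefficient
    of z1^2 in the pulled back tube is -y'/(2y) + M'/(2M).  Since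
    tau := t + y'/(2y) satisfies the Cauchy-Riemann equations
    ([hol_at_completed_coefficient]), the difference M'/(2M) - tau of the two
    coefficients is holomorphic, and [equivalent_to_tube] concludes. *)

Local Open Scope C_scope.

(** * Complex and real differentiability in one complex variable *)

(** Complex differentiability for the uniform structure of [C_NormedModule],
    whose balls are squares; [is_derive] over [C_AbsRing] uses discs. *)
Definition hol_at (k : C -> C) (z d : C) : Prop :=
  filterdiff (K := C_AbsRing) (U := C_NormedModule) (V := C_NormedModule)
    k (locally z) (fun y : C => y * d).

Definition real_diff (f : R * R -> R) (z : R * R) (a b : R) : Prop :=
  filterdiff (K := R_AbsRing) (U := C_R_NormedModule) (V := R_NormedModule)
    f (locally z) (fun w : R * R => (fst w * a + snd w * b)%R).

Lemma is_linear_Cmult (d : C) :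
  is_linear (K := C_AbsRing) (U := C_NormedModule) (V := C_NormedModule)
    (fun y : C => y * d).
Proof.
split.
- intros x y. change ((x + y) * d = x * d + y * d). ring.
- intros k x. change ((k * x) * d = k * (x * d)). ring.
- exists (Cmod d + 1)%R. split.
  + generalize (Cmod_ge_0 d); lra.
  + intros x. change (Cmod (x * d) <= (Cmod d + 1) * Cmod x)%R.
    rewrite Cmod_mult. generalize (Cmod_ge_0 x); nra.
Qed.

Lemma norm_C_R_Cmod (w : C) : norm (V := C_R_NormedModule) w = Cmod w.
Proof.
destruct w as [a b].
change (sqrt (Rabs a ^ 2 + Rabs b ^ 2) = sqrt (a ^ 2 + b ^ 2)).
now rewrite !pow2_abs.
Qed.

Lemma Cmod_le_re_im (w : C) : (Cmod w <= Rabs (fst w) + Rabs (snd w))%R.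
Proof.
destruct w as [a b]. simpl fst; simpl snd.
replace ((a, b) : C) with (RtoC a + Ci * RtoC b)
  by (apply injective_projections; simpl; ring).
eapply Rle_trans; [apply Cmod_triangle|].
rewrite Cmod_mult, !Cmod_R.
replace (Cmod Ci) with 1%R; [lra|].
unfold Cmod; simpl. replace (0 * (0 * 1) + 1 * (1 * 1))%R with 1%R by ring.
now rewrite sqrt_1.
Qed.

(** The Cauchy-Riemann equations make the real differential commute with
    multiplication by i, hence equal to multiplication by a - i b. *)
Lemma cauchy_riemann (u v : R * R -> R) (z : C) (a b : R) :
  real_diff u z a b -> real_diff v z (- b) a ->
  hol_at (fun w : C => (u w, v w)) z (a, - b)%R.
Proof.
intros [_ Hu] [_ Hv]. split.
- apply is_linear_Cmult.
- intros x Hx.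
  assert (Hx' : is_filter_lim (T := C_R_NormedModule) (locally z) x) by exact Hx.
  specialize (Hu x Hx'). specialize (Hv x Hx').
  intros eps.
  generalize (Hu (pos_div_2 eps)) (Hv (pos_div_2 eps)); clear Hu Hv.
  intros Hu Hv. generalize (filter_and _ _ Hu Hv); clear Hu Hv.
  apply filter_imp. intros w [H1 H2].
  rewrite norm_C_R_Cmod in H1, H2.
  refine (Rle_trans _ _ _ (Cmod_le_re_im _) _).
  destruct w as [p q], x as [p0 q0].
  change (Rabs (u (p, q) - u (p0, q0) - ((p - p0) * a + (q - q0) * b))
            <= eps / 2 * Cmod ((p, q) - (p0, q0))%C)%R in H1.
  change (Rabs (v (p, q) - v (p0, q0) - ((p - p0) * - b + (q - q0) * a))
            <= eps / 2 * Cmod ((p, q) - (p0, q0))%C)%R in H2.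
  change (Rabs (u (p, q) - u (p0, q0) - ((p - p0) * a - (q - q0) * - b)) +
          Rabs (v (p, q) - v (p0, q0) - ((p - p0) * - b + (q - q0) * a))
            <= eps * Cmod ((p, q) - (p0, q0))%C)%R.
  replace ((p - p0) * a - (q - q0) * - b)%R
    with ((p - p0) * a + (q - q0) * b)%R by ring.
  lra.
Qed.

(** The remainder of the first-order expansion of 1/w at z is exactly
    (w - z)^2/(w z^2). *)
Lemma hol_at_Cinv (z : C) : z <> 0 -> hol_at Cinv z (- / (z * z)).
Proof.
intros Hz. split; [apply is_linear_Cmult|].
intros x Hx.
assert (E : z = x).
{ apply (is_filter_lim_locally_unique (V := C_NormedModule)); exact Hx. }
subst x. clear Hx. intros eps.
assert (Hm : (0 < Cmod z)%R) by now apply Cmod_gt_0.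
set (m := Cmod z) in *.
(* The bound m/2 keeps |w| >= m/2; then the remainder is at most
   |w - z|^2 * 2/m^3, and the second bound makes this at most eps |w - z|. *)
assert (Hd : (0 < Rmin (m / 2) (eps * (m * m * m) / 2))%R).
{ apply Rmin_pos; [lra|]. destruct eps as [e He]; simpl.
  apply Rdiv_lt_0_compat; [|lra]. apply Rmult_lt_0_compat; [lra|].
  repeat apply Rmult_lt_0_compat; lra. }
apply (locally_le_locally_norm (V := C_NormedModule)).
exists (mkposreal _ Hd). intros w Hw. change C in w.
unfold ball_norm in Hw.
change (Cmod (w - z) < Rmin (m / 2) (eps * (m * m * m) / 2))%R in Hw.
change (Cmod (/ w - / z - (w - z) * - / (z * z)) <= eps * Cmod (w - z))%R.
assert (Hw1 : (Cmod (w - z) < m / 2)%R) by (eapply Rlt_le_trans; [exact Hw|apply Rmin_l]).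
assert (Hw2 : (Cmod (w - z) < eps * (m * m * m) / 2)%R)
  by (eapply Rlt_le_trans; [exact Hw|apply Rmin_r]).
assert (Hw3 : (m / 2 <= Cmod w)%R).
{ generalize (Cmod_triangle w (- (w - z))).
  replace (w + - (w - z)) with z by ring. rewrite Cmod_opp. fold m. lra. }
assert (Hw0 : w <> 0) by (apply Cmod_gt_0; lra).
replace (/ w - / z - (w - z) * - / (z * z)) with
  ((w - z) * (w - z) * / (w * z * z)) by (field; auto).
assert (Hn : w * z * z <> 0) by (repeat apply Cmult_neq_0; auto).
rewrite !Cmod_mult, Cmod_inv, !Cmod_mult. fold m.
set (n := Cmod w) in *. set (q := Cmod (w - z)) in *.
assert (Hq : (0 <= q)%R) by apply Cmod_ge_0.
assert (Hpos : (0 < n * m * m)%R) by (repeat apply Rmult_lt_0_compat; lra).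
apply Rmult_le_reg_r with (1 := Hpos).
replace (q * q * / (n * m * m) * (n * m * m))%R with (q * q)%R
  by (field; repeat split; lra).
replace (eps * q * (n * m * m))%R with (q * (eps * (n * m * m)))%R by ring.
apply Rmult_le_compat_l; [assumption|].
destruct eps as [e He]; simpl in *.
apply Rle_trans with (e * (m * m * m) / 2)%R; [lra|].
replace (e * (m * m * m) / 2)%R with (e * ((m / 2) * m * m))%R by field.
apply Rmult_le_compat_l; [lra|].
repeat apply Rmult_le_compat_r; try lra.
assumption.
Qed.

(** The two normed-module structures of C, with square and with round balls,
    share their norm, which is all that the target of a differential
    contributes; this gives access to the product rule. *)
Lemma filterdiff_C_AbsRing {U : NormedModule C_AbsRing} (f : U -> C)
    (F : (U -> Prop) -> Prop) (l : U -> C) :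
  filterdiff (K := C_AbsRing) (V := C_NormedModule) f F l <->
  filterdiff (K := C_AbsRing) (V := AbsRing_NormedModule C_AbsRing) f F l.
Proof.
split; intros [[L1 L2 L3] H]; (split; [split; [exact L1|exact L2|exact L3]|exact H]).
Qed.

Lemma filterdiff_Cmult {U : NormedModule C_AbsRing} (f g : U -> C) (x : U)
    (lf lg : U -> C) :
  filterdiff (K := C_AbsRing) (V := C_NormedModule) f (locally x) lf ->
  filterdiff (K := C_AbsRing) (V := C_NormedModule) g (locally x) lg ->
  filterdiff (K := C_AbsRing) (V := C_NormedModule) (fun t => f t * g t) (locally x)
    (fun t => lf t * g x + f x * lg t).
Proof.
intros Hf Hg.
apply filterdiff_C_AbsRing in Hf. apply filterdiff_C_AbsRing in Hg.
apply filterdiff_C_AbsRing.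
exact (filterdiff_mult_fct (K := C_AbsRing) f g x lf lg Cmult_comm Hf Hg).
Qed.

Lemma filterdiff_hol {U : NormedModule C_AbsRing} (f : U -> C) (k : C -> C)
    (x : U) (lf : U -> C) (d : C) :
  filterdiff (K := C_AbsRing) (V := C_NormedModule) f (locally x) lf ->
  hol_at k (f x) d ->
  filterdiff (K := C_AbsRing) (V := C_NormedModule) (fun t => k (f t)) (locally x)
    (fun t => lf t * d).
Proof.
intros Hf Hk.
exact (filterdiff_comp' (V := C_NormedModule) (W := C_NormedModule) f k x lf _ Hf Hk).
Qed.

Lemma hol_at_eq (k : C -> C) (z d d' : C) : hol_at k z d -> d = d' -> hol_at k z d'.
Proof. now intros H <-. Qed.

Lemma hol_at_const (a z : C) : hol_at (fun _ => a) z 0.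
Proof.
eapply filterdiff_ext_lin.
- apply (filterdiff_const (K := C_AbsRing) (U := C_NormedModule) (V := C_NormedModule)).
- intros y. change (RtoC 0 = y * 0). ring.
Qed.

Lemma hol_at_plus (k l : C -> C) (z a b : C) :
  hol_at k z a -> hol_at l z b -> hol_at (fun w => k w + l w) z (a + b).
Proof.
intros Hk Hl. eapply filterdiff_ext_lin.
- apply (filterdiff_plus_fct (K := C_AbsRing) (U := C_NormedModule) (V := C_NormedModule)
   k l (fun y => y * a) (fun y => y * b) Hk Hl).
- intros y. change (y * a + y * b = y * (a + b)). ring.
Qed.

Lemma hol_at_mult (k l : C -> C) (z a b : C) :
  hol_at k z a -> hol_at l z b -> hol_at (fun w => k w * l w) z (a * l z + k z * b).
Proof.
intros Hk Hl. eapply filterdiff_ext_lin.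
- apply (filterdiff_Cmult (U := C_NormedModule) k l z _ _ Hk Hl).
- intros y. change (y * a * l z + k z * (y * b) = y * (a * l z + k z * b)). ring.
Qed.

Lemma hol_at_scal (k : C -> C) (z a q : C) :
  hol_at k z a -> hol_at (fun w => q * k w) z (q * a).
Proof.
intros H. apply (hol_at_eq _ _ (0 * k z + q * a)); [|ring].
exact (hol_at_mult _ _ _ _ _ (hol_at_const q z) H).
Qed.

Lemma hol_at_inv (k : C -> C) (z a : C) : k z <> 0 ->
  hol_at k z a -> hol_at (fun w => / k w) z (a * - / (k z * k z)).
Proof.
intros H0 H. eapply filterdiff_ext_lin.
- apply (filterdiff_hol (U := C_NormedModule) k Cinv z _ _ H (hol_at_Cinv _ H0)).
- intros y. change (y * a * - / (k z * k z) = y * (a * - / (k z * k z))). ring.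
Qed.

(** * Real differentials of functions on the plane *)

Local Open Scope R_scope.

Lemma real_diff_eq (f : R * R -> R) (z : R * R) (a b a' b' : R) :
  real_diff f z a b -> a = a' -> b = b' -> real_diff f z a' b'.
Proof. now intros H <- <-. Qed.

Lemma real_diff_fst (u : R -> R) (z : R * R) (u' : R) :
  is_derive u (fst z) u' -> real_diff (fun w : R * R => u (fst w)) z u' 0.
Proof.
intros Hu.
apply filterdiff_ext_lin with (fun w : R * R => scal (fst w) u').
- apply (filterdiff_comp' (K := R_AbsRing) (U := C_R_NormedModule)
    (V := R_NormedModule) (W := R_NormedModule) (fun w : R * R => fst w) u z
    (fun w : R * R => fst w) (fun y : R => scal y u')).
  + apply (filterdiff_linear (U := C_R_NormedModule) (V := R_NormedModule)).
    apply (is_linear_fst (U := R_NormedModule) (V := R_NormedModule)).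
  + exact Hu.
- intros w. change (fst w * u' = fst w * u' + snd w * 0). ring.
Qed.

Lemma real_diff_snd (u : R -> R) (z : R * R) (u' : R) :
  is_derive u (snd z) u' -> real_diff (fun w : R * R => u (snd w)) z 0 u'.
Proof.
intros Hu.
apply filterdiff_ext_lin with (fun w : R * R => scal (snd w) u').
- apply (filterdiff_comp' (K := R_AbsRing) (U := C_R_NormedModule)
    (V := R_NormedModule) (W := R_NormedModule) (fun w : R * R => snd w) u z
    (fun w : R * R => snd w) (fun y : R => scal y u')).
  + apply (filterdiff_linear (U := C_R_NormedModule) (V := R_NormedModule)).
    apply (is_linear_snd (U := R_NormedModule) (V := R_NormedModule)).
  + exact Hu.
- intros w. change (snd w * u' = fst w * 0 + snd w * u'). ring.
Qed.

Lemma real_diff_mult (f g : R * R -> R) (z : R * R) (a b a' b' : R) :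
  real_diff f z a b -> real_diff g z a' b' ->
  real_diff (fun w => f w * g w) z (a * g z + f z * a') (b * g z + f z * b').
Proof.
intros Hf Hg.
eapply filterdiff_ext_lin.
- exact (filterdiff_mult_fct (K := R_AbsRing) (U := C_R_NormedModule) f g z _ _
    Rmult_comm Hf Hg).
- intros w.
  change ((fst w * a + snd w * b) * g z + f z * (fst w * a' + snd w * b') =
   fst w * (a * g z + f z * a') + snd w * (b * g z + f z * b')). ring.
Qed.

Lemma real_diff_lin (f g : R * R -> R) (z : R * R) (a b a' b' k : R) :
  real_diff f z a b -> real_diff g z a' b' ->
  real_diff (fun w => f w + k * g w) z (a + k * a') (b + k * b').
Proof.
intros Hf Hg.
eapply filterdiff_ext_lin.
- apply (filterdiff_plus_fct (K := R_AbsRing) (U := C_R_NormedModule)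
    (V := R_NormedModule) f (fun w => scal k (g w)) _
    (fun w => scal k (fst w * a' + snd w * b')) Hf).
  apply (filterdiff_scal_r_fct (K := R_AbsRing) (U := C_R_NormedModule)
    (V := R_NormedModule) k g _ Rmult_comm Hg).
- intros w.
  change ((fst w * a + snd w * b) + k * (fst w * a' + snd w * b') =
   fst w * (a + k * a') + snd w * (b + k * b')). ring.
Qed.

(** * Directional derivatives and Wirtinger operators *)

Definition dirD (v : C) (f : C -> R) (z : C) : R :=
  Derive (fun s : R => f (z + RtoC s * v)%C) 0.

(** Continuity of the first derivatives yields a total differential, hence
    holomorphy from the Cauchy-Riemann equations; the second derivatives enter
    the Levi condition and have to exist to be additive. *)
Definition twice_diff_at (f : C -> R) (z : C) : Prop :=
  forall v : C,
    ex_derive (fun s : R => f (z + RtoC s * v)%C) 0 /\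
    continuous (U := R_UniformSpace) (T := C_R_NormedModule) (dirD v f) z /\
    forall v' : C, ex_derive (fun s : R => dirD v' f (z + RtoC s * v)%C) 0.

Lemma translate_C (z v : C) (s : R) :
  plus (z : C_R_NormedModule) (scal s (v : C_R_NormedModule)) = (z + RtoC s * v)%C.
Proof.
apply injective_projections.
- change (fst z + s * fst v = fst z + (s * fst v - 0 * snd v)). ring.
- change (snd z + s * snd v = snd z + (s * snd v + 0 * fst v)). ring.
Qed.

Lemma smooth_near_twice_diff (f : C -> R) (z0 : C) :
  smooth_near (V := C_R_NormedModule) f z0 ->
  locally (z0 : C_R_NormedModule) (twice_diff_at f).
Proof.
intros (U & HU & Uz & Hf). apply (filter_imp U); [|now apply HU].
intros z Hz v. specialize (Hf 2%nat). destruct Hf as [_ Hf].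
assert (E : forall v z, Derive (fun s : R => f (plus (z : C_R_NormedModule)
   (scal s (v : C_R_NormedModule)))) 0 = dirD v f z).
{ intros w p. apply Derive_ext. intros s. now rewrite translate_C. }
split; [|split].
- apply (ex_derive_ext (fun s : R => f (plus (z : C_R_NormedModule)
   (scal s (v : C_R_NormedModule))))).
  + intros s. now rewrite translate_C.
  + destruct (Hf v) as [H1 _]. exact (H1 z Hz).
- destruct (Hf v) as [_ [Hc _]].
  apply (continuous_ext (T := C_R_NormedModule) (U := R_UniformSpace) _ _ _ (E v)).
  exact (Hc z Hz).
- intros v'. destruct (Hf v') as [_ [_ H2]].
  destruct (H2 v) as [H3 _].
  refine (ex_derive_ext _ _ _ _ (H3 z Hz)).
  intros s. cbv beta. now rewrite E, translate_C.
Qed.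

Lemma smooth_near_R_twice (f : R -> R) (x0 : R) :
  smooth_near (V := R_NormedModule) f x0 ->
  locally x0 (fun x => is_derive f x (Derive f x) /\
                       is_derive (Derive f) x (Derive (Derive f) x)).
Proof.
intros (U & HU & U0 & Hf). apply (filter_imp U); [|now apply HU].
intros x Ux. destruct (Hf 2%nat) as [_ H2].
set (line := fun (g : R -> R) (p s : R) =>
  g (plus (p : R_NormedModule) (scal s (1 : R_NormedModule)))).
assert (T : forall (g : R -> R) (p : R),
  ex_derive (line g p) 0 -> is_derive g p (Derive (line g p) 0)).
{ intros g p Hg. apply Derive_correct in Hg.
  set (l := Derive _ _) in *.
  apply (is_derive_ext (fun a : R => line g p (a - p))).
  - intros a. change (g (p + (a - p) * 1) = g a). f_equal. ring.
  - rewrite <- (Rmult_1_l l).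
    apply (is_derive_comp (K := R_AbsRing) (V := R_NormedModule) (line g p)
      (fun a => a - p)).
    + rewrite Rminus_diag. exact Hg.
    + auto_derive; trivial. }
destruct (H2 1) as [E1 [_ H3]]. destruct (H3 1) as [E2 _].
split; apply Derive_correct.
- eexists. exact (T f x (E1 x Ux)).
- eexists.
  apply (is_derive_ext_loc (fun p : R => Derive (line f p) 0)).
  + apply (filter_imp U); [|now apply HU]. intros p Up.
    symmetry. apply is_derive_unique. exact (T f p (E1 p Up)).
  + exact (T _ x (E2 x Ux)).
Qed.

Lemma locally_line (P : C -> Prop) (z v : C) :
  locally (z : C_R_NormedModule) P -> locally 0 (fun s : R => P (z + RtoC s * v)%C).
Proof.
intros [eps H]. set (K := Rabs (fst v) + Rabs (snd v) + 1).
assert (HK : 0 < K).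
{ unfold K. generalize (Rabs_pos (fst v)) (Rabs_pos (snd v)); lra. }
assert (Hd : 0 < eps / K).
{ apply Rdiv_lt_0_compat; [apply cond_pos|exact HK]. }
exists (mkposreal _ Hd). intros s Hs. apply H.
assert (Hs' : Rabs s * K < eps).
{ change (Rabs (s - 0) < eps / K) in Hs. rewrite Rminus_0_r in Hs.
  apply Rmult_lt_compat_r with (1 := HK) in Hs.
  replace (eps / K * K) with (pos eps) in Hs; [exact Hs|]. field. lra. }
assert (B1 : Rabs s * Rabs (fst v) <= Rabs s * K).
{ apply Rmult_le_compat_l; [apply Rabs_pos|]. unfold K.
  generalize (Rabs_pos (snd v)); lra. }
assert (B2 : Rabs s * Rabs (snd v) <= Rabs s * K).
{ apply Rmult_le_compat_l; [apply Rabs_pos|]. unfold K.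
  generalize (Rabs_pos (fst v)); lra. }
split.
- change (Rabs (fst z + (s * fst v - 0 * snd v) - fst z) < eps).
  replace (fst z + (s * fst v - 0 * snd v) - fst z) with (s * fst v) by ring.
  rewrite Rabs_mult. lra.
- change (Rabs (snd z + (s * snd v + 0 * fst v) - snd z) < eps).
  replace (snd z + (s * snd v + 0 * fst v) - snd z) with (s * snd v) by ring.
  rewrite Rabs_mult. lra.
Qed.

Lemma dirD_ext_loc (v : C) (f g : C -> R) (z : C) :
  locally (z : C_R_NormedModule) (fun w => f w = g w) -> dirD v f z = dirD v g z.
Proof.
intros H. apply Derive_ext_loc.
exact (locally_line (fun w => f w = g w) z v H).
Qed.

(** Continuous partial derivatives imply total differentiability. *)
Lemma twice_diff_real_diff (f : C -> R) (z : C) :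
  locally (z : C_R_NormedModule) (twice_diff_at f) ->
  real_diff f z (dirD (RtoC 1) f z) (dirD Ci f z).
Proof.
intros H.
assert (Hx : forall x y, twice_diff_at f (x, y) ->
  is_derive (fun a : R => f (a, y)) x (dirD (RtoC 1) f (x, y))).
{ intros x y Ht. destruct (Ht (RtoC 1)) as [H1 _].
  apply Derive_correct in H1. fold (dirD (RtoC 1) f (x, y)) in H1.
  apply (is_derive_ext (fun a : R =>
     (fun s : R => f ((x, y) + RtoC s * RtoC 1)%C) (a - x))).
  - intros a. cbv beta. f_equal. apply injective_projections; simpl; ring.
  - rewrite <- (Rmult_1_l (dirD _ _ _)).
    apply (is_derive_comp (K := R_AbsRing) (V := R_NormedModule)
      (fun s : R => f ((x, y) + RtoC s * RtoC 1)%C) (fun a => a - x)).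
    + rewrite Rminus_diag. exact H1.
    + auto_derive; trivial. }
destruct z as [x y].
assert (Hy : is_derive (fun a : R => f (x, a)) y (dirD Ci f (x, y))).
{ destruct (locally_singleton _ _ H Ci) as [H1 _].
  apply Derive_correct in H1. fold (dirD Ci f (x, y)) in H1.
  apply (is_derive_ext (fun a : R =>
     (fun s : R => f ((x, y) + RtoC s * Ci)%C) (a - y))).
  - intros a. cbv beta. f_equal. apply injective_projections; simpl; ring.
  - rewrite <- (Rmult_1_l (dirD _ _ _)).
    apply (is_derive_comp (K := R_AbsRing) (V := R_NormedModule)
      (fun s : R => f ((x, y) + RtoC s * Ci)%C) (fun a => a - y)).
    + rewrite Rminus_diag. exact H1.
    + auto_derive; trivial. }
pose proof (is_derive_filterdiff (fun a b => f (a, b)) x y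
  (fun a b => dirD (RtoC 1) f (a, b)) (dirD Ci f (x, y))) as Q.
refine (filterdiff_ext _ _ _ _ (Q _ Hy _)).
- intros [a b]. easy.
- revert H. apply filter_imp. intros [a b] Ht. now apply Hx.
- destruct (locally_singleton _ _ H (RtoC 1)) as [_ [Hc _]].
  refine (continuous_ext _ _ _ _ Hc). now intros [a b].
Qed.

Lemma fst_wirt (g : C -> C) (z : C) : fst (wirt g z) =
  (dirD (RtoC 1) (fun w => Re (g w)) z + dirD Ci (fun w => Im (g w)) z) / 2.
Proof.
change (fst (wirt g z)) with
 (fst ((Cdir (RtoC 1) g z - Ci * Cdir Ci g z) / RtoC 2)%C).
unfold Cdir, dirD. simpl. field.
Qed.
Lemma snd_wirt (g : C -> C) (z : C) : snd (wirt g z) =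
  (dirD (RtoC 1) (fun w => Im (g w)) z - dirD Ci (fun w => Re (g w)) z) / 2.
Proof.
change (snd (wirt g z)) with
 (snd ((Cdir (RtoC 1) g z - Ci * Cdir Ci g z) / RtoC 2)%C).
unfold Cdir, dirD. simpl. field.
Qed.
Lemma fst_wirtb (g : C -> C) (z : C) : fst (wirtb g z) =
  (dirD (RtoC 1) (fun w => Re (g w)) z - dirD Ci (fun w => Im (g w)) z) / 2.
Proof.
change (fst (wirtb g z)) with
 (fst ((Cdir (RtoC 1) g z + Ci * Cdir Ci g z) / RtoC 2)%C).
unfold Cdir, dirD. simpl. field.
Qed.
Lemma snd_wirtb (g : C -> C) (z : C) : snd (wirtb g z) =
  (dirD (RtoC 1) (fun w => Im (g w)) z + dirD Ci (fun w => Re (g w)) z) / 2.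
Proof.
change (snd (wirtb g z)) with
 (snd ((Cdir (RtoC 1) g z + Ci * Cdir Ci g z) / RtoC 2)%C).
unfold Cdir, dirD. simpl. field.
Qed.

Lemma wirtb_ext_loc (f g : C -> C) (z : C) :
  locally (z : C_R_NormedModule) (fun w => f w = g w) -> wirtb f z = wirtb g z.
Proof.
intros H.
assert (H1 : locally (z : C_R_NormedModule) (fun w => Re (f w) = Re (g w))).
{ revert H. apply filter_imp. now intros w ->. }
assert (H2 : locally (z : C_R_NormedModule) (fun w => Im (f w) = Im (g w))).
{ revert H. apply filter_imp. now intros w ->. }
apply injective_projections; [rewrite !fst_wirtb|rewrite !snd_wirtb];
now rewrite !(dirD_ext_loc _ _ _ _ H1), !(dirD_ext_loc _ _ _ _ H2).
Qed.

(** * Boxes around the origin *)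

(** Squares are the balls of C as a uniform space, and products of squares are
    those of its powers. *)
Definition box (e : R) (z : C) : Prop := Rabs (fst z) < e /\ Rabs (snd z) < e.

Lemma near0_box (P : C -> C -> Prop) : near0 P ->
  exists e, 0 < e /\ forall z1 z2, box e z1 -> box e z2 -> P z1 z2.
Proof.
intros [e H]. exists e. split; [apply cond_pos|].
intros z1 z2 [H1 H2] [H3 H4]. apply (H (z1, z2)).
split; split; [set (x := fst z1) in *|set (x := snd z1) in *|
  set (x := fst z2) in *|set (x := snd z2) in *];
  change (Rabs (x - 0) < e); now rewrite Rminus_0_r.
Qed.

Lemma locally_box (P : C -> Prop) : locally (RtoC 0 : C_R_NormedModule) P ->
  exists e, 0 < e /\ forall z, box e z -> P z.
Proof.
intros [e H]. exists e. split; [apply cond_pos|].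
intros z [H1 H2]. apply H.
split; [set (x := fst z) in *|set (x := snd z) in *];
  change (Rabs (x - 0) < e); now rewrite Rminus_0_r.
Qed.

Lemma box_open (e : R) (z : C) : box e z -> locally (z : C_R_NormedModule) (box e).
Proof.
intros [H1 H2].
assert (Hd : 0 < Rmin (e - Rabs (fst z)) (e - Rabs (snd z))) by (apply Rmin_pos; lra).
exists (mkposreal _ Hd). intros w [H3 H4].
change (Rabs (fst w - fst z) < Rmin (e - Rabs (fst z)) (e - Rabs (snd z))) in H3.
change (Rabs (snd w - snd z) < Rmin (e - Rabs (fst z)) (e - Rabs (snd z))) in H4.
pose proof (Rmin_l (e - Rabs (fst z)) (e - Rabs (snd z))).
pose proof (Rmin_r (e - Rabs (fst z)) (e - Rabs (snd z))).
pose proof (Rabs_triang (fst w - fst z) (fst z)).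
pose proof (Rabs_triang (snd w - snd z) (snd z)).
replace (fst w - fst z + fst z) with (fst w) in * by ring.
replace (snd w - snd z + snd z) with (snd w) in * by ring.
split; lra.
Qed.

Lemma box_locally (e : R) (P : C -> Prop) (z : C) :
  (forall w, box e w -> P w) -> box e z -> locally (z : C_R_NormedModule) P.
Proof. intros H Hz. apply (filter_imp (box e)); [exact H|now apply box_open]. Qed.

Lemma box_le (e e' : R) (z : C) : e <= e' -> box e z -> box e' z.
Proof. intros H [H1 H2]. split; lra. Qed.

Lemma box_double (e : R) (z : C) : box e z -> Rabs (2 * fst z) < 2 * e.
Proof. intros [H _]. rewrite Rabs_mult, (Rabs_right 2); lra. Qed.

Lemma near0_and (P Q : C -> C -> Prop) :
  near0 P -> near0 Q -> near0 (fun z1 z2 => P z1 z2 /\ Q z1 z2).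
Proof. exact (filter_and (fun p : C2R => P (fst p) (snd p)) (fun p => Q (fst p) (snd p))). Qed.

(** * The Levi condition as an ordinary differential equation *)

(** r |w|^2 + 2 Re (t w^2) in real coordinates. *)
Definition real_part_quadratic (r : R) (t w : C) : R :=
  r * (fst w * fst w + snd w * snd w) +
  2 * (fst t * (fst w * fst w - snd w * snd w) - 2 * snd t * (fst w * snd w)).

Lemma Cmod_sqr (w : C) : Cmod w ^ 2 = fst w * fst w + snd w * snd w.
Proof.
unfold Cmod. rewrite pow2_sqrt; [ring|]. generalize (pow2_ge_0 (fst w)) (pow2_ge_0 (snd w)); lra.
Qed.

Lemma quadratic_real_form (x r : R) (t w : C) :
  (RtoC x = RtoC r * RtoC (Cmod w ^ 2)%R + t * w ^ 2 + Cconj t * Cconj w ^ 2)%C ->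
  x = real_part_quadratic r t w.
Proof.
intros H. apply (f_equal fst) in H. rewrite Cmod_sqr in H.
unfold real_part_quadratic. simpl in H. rewrite H. ring.
Qed.

Lemma wirt_quadratic (g : C -> C) (r : R) (t z : C) :
  locally (z : C_R_NormedModule) (fun w => g w = RtoC (real_part_quadratic r t w)) ->
  wirt g z = (RtoC r * Cconj z + 2 * t * z)%C.
Proof.
intros H.
assert (H1 : locally (z : C_R_NormedModule)
  (fun w => Re (g w) = real_part_quadratic r t w)).
{ revert H. apply filter_imp. now intros w ->. }
assert (H2 : locally (z : C_R_NormedModule) (fun w => Im (g w) = 0)).
{ revert H. apply filter_imp. now intros w ->. }
apply injective_projections; [rewrite fst_wirt|rewrite snd_wirt];
rewrite !(dirD_ext_loc _ _ _ _ H1), !(dirD_ext_loc _ _ _ _ H2);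
unfold dirD; rewrite Derive_const; unfold real_part_quadratic; simpl.
- erewrite is_derive_unique; [|auto_derive; [easy|reflexivity]]. field.
- erewrite is_derive_unique; [|auto_derive; [easy|reflexivity]]. field.
Qed.

Lemma wirtb_linear (g : C -> C) (r : R) (t z : C) :
  locally (z : C_R_NormedModule) (fun w => g w = (RtoC r * Cconj w + 2 * t * w)%C) ->
  wirtb g z = RtoC r.
Proof.
intros H.
assert (H1 : locally (z : C_R_NormedModule)
  (fun w => Re (g w) = Re (RtoC r * Cconj w + 2 * t * w)%C)).
{ revert H. apply filter_imp. now intros w ->. }
assert (H2 : locally (z : C_R_NormedModule)
  (fun w => Im (g w) = Im (RtoC r * Cconj w + 2 * t * w)%C)).
{ revert H. apply filter_imp. now intros w ->. }
apply injective_projections; [rewrite fst_wirtb|rewrite snd_wirtb];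
rewrite !(dirD_ext_loc _ _ _ _ H1), !(dirD_ext_loc _ _ _ _ H2);
unfold dirD; simpl.
- erewrite is_derive_unique; [|auto_derive; [easy|reflexivity]].
  erewrite is_derive_unique; [|auto_derive; [easy|reflexivity]]. field.
- erewrite is_derive_unique; [|auto_derive; [easy|reflexivity]].
  erewrite is_derive_unique; [|auto_derive; [easy|reflexivity]]. field.
Qed.

Lemma dirD_lin (v : C) (f g : C -> R) (a b : R) (z : C) :
  twice_diff_at f z -> twice_diff_at g z ->
  dirD v (fun w => a * f w + b * g w) z = a * dirD v f z + b * dirD v g z.
Proof.
intros Hf Hg. destruct (Hf v) as [Hf1 _], (Hg v) as [Hg1 _].
unfold dirD. rewrite Derive_plus, !Derive_scal; [reflexivity| |];
 now apply ex_derive_scal.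
Qed.

Lemma dirD2_lin (v v' : C) (f g : C -> R) (a b : R) (z : C) :
  locally (z : C_R_NormedModule) (twice_diff_at f) ->
  locally (z : C_R_NormedModule) (twice_diff_at g) ->
  dirD v (dirD v' (fun w => a * f w + b * g w)) z =
  a * dirD v (dirD v' f) z + b * dirD v (dirD v' g) z.
Proof.
intros Hf Hg.
rewrite (dirD_ext_loc _ _ (fun w => a * dirD v' f w + b * dirD v' g w)).
- destruct (locally_singleton _ _ Hf v) as [_ [_ Hf1]].
  destruct (locally_singleton _ _ Hg v) as [_ [_ Hg1]].
  unfold dirD at 1. rewrite Derive_plus, !Derive_scal; [reflexivity| |];
  apply ex_derive_scal; [apply Hf1|apply Hg1].
- generalize (filter_and _ _ Hf Hg). apply filter_imp.
  intros w [H1 H2]. now apply dirD_lin.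
Qed.

(** For a real function u the real part of u_{z \bar z} is a quarter of the
    Laplacian, where no mixed partial derivative occurs; those cancel only in
    the imaginary part, by the symmetry of second derivatives. *)
Lemma fst_wirtb_wirt_real (g : C -> C) (u : C -> R) (z : C) :
  locally (z : C_R_NormedModule) (fun w => g w = RtoC (u w)) ->
  fst (wirtb (wirt g) z) =
  (dirD (RtoC 1) (dirD (RtoC 1) u) z + dirD Ci (dirD Ci u) z) / 4.
Proof.
intros H. apply locally_locally in H.
assert (H1 : locally (z : C_R_NormedModule)
  (fun w => Re (wirt g w) = / 2 * dirD (RtoC 1) u w)).
{ revert H. apply filter_imp. intros w Hw. change (Re (wirt g w)) with (fst (wirt g w)).
  rewrite fst_wirt.
  rewrite (dirD_ext_loc Ci _ (fun _ => 0)), (dirD_ext_loc (RtoC 1) _ u).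
  - unfold dirD at 2. rewrite Derive_const. field.
  - revert Hw. apply filter_imp. now intros p ->.
  - revert Hw. apply filter_imp. now intros p ->. }
assert (H2 : locally (z : C_R_NormedModule)
  (fun w => Im (wirt g w) = - / 2 * dirD Ci u w)).
{ revert H. apply filter_imp. intros w Hw. change (Im (wirt g w)) with (snd (wirt g w)).
  rewrite snd_wirt.
  rewrite (dirD_ext_loc (RtoC 1) _ (fun _ => 0)), (dirD_ext_loc Ci _ u).
  - unfold dirD at 1. rewrite Derive_const. field.
  - revert Hw. apply filter_imp. now intros p ->.
  - revert Hw. apply filter_imp. now intros p ->. }
rewrite fst_wirtb, (dirD_ext_loc _ _ _ _ H1), (dirD_ext_loc _ _ _ _ H2).
unfold dirD at 1 3. rewrite !Derive_scal.
change (Derive (fun s => dirD (RtoC 1) u (z + RtoC s * RtoC 1)%C) 0) with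
 (dirD (RtoC 1) (dirD (RtoC 1) u) z).
change (Derive (fun s => dirD Ci u (z + RtoC s * Ci)%C) 0) with
 (dirD Ci (dirD Ci u) z). field.
Qed.

Lemma dirD_fst (v : C) (f : C -> R) (g : R -> R) (z : C) (l : R) :
  locally (z : C_R_NormedModule) (fun w => f w = g (2 * fst w)) ->
  is_derive g (2 * fst z) l -> dirD v f z = 2 * fst v * l.
Proof.
intros Hf Hg. rewrite (dirD_ext_loc _ _ _ _ Hf).
apply is_derive_unique.
apply (is_derive_comp (K := R_AbsRing) (V := R_NormedModule) g
  (fun s : R => 2 * fst (z + RtoC s * v)%C)).
- simpl. replace (2 * (fst z + (0 * fst v - 0 * snd v))) with (2 * fst z) by ring.
  exact Hg.
- simpl. auto_derive; [easy|]. ring.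
Qed.

Lemma wirtb_mixed (r : C -> R) (t : C -> C) (z1 z : C) :
  twice_diff_at r z ->
  twice_diff_at (fun w => Re (t w)) z -> twice_diff_at (fun w => Im (t w)) z ->
  wirtb (fun w => RtoC (r w) * Cconj z1 + 2 * t w * z1)%C z =
  (wirtb (fun w => RtoC (r w)) z * Cconj z1 + 2 * wirtb t z * z1)%C.
Proof.
intros Hr H1 H2.
assert (L : forall v a b c, dirD v
  (fun w => a * r w + (b * Re (t w) + c * Im (t w))) z =
  a * dirD v r z + (b * dirD v (fun w => Re (t w)) z + c * dirD v (fun w => Im (t w)) z)).
{ intros v a b c. rewrite <- (dirD_lin v _ _ b c z H1 H2).
  destruct (Hr v) as [Er _], (H1 v) as [E1 _], (H2 v) as [E2 _].
  unfold dirD. rewrite Derive_plus.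
  - now rewrite Derive_scal.
  - now apply ex_derive_scal.
  - apply (ex_derive_plus (K := R_AbsRing) (V := R_NormedModule));
      now apply ex_derive_scal. }
assert (ERe : forall v, dirD v
  (fun w => Re (RtoC (r w) * Cconj z1 + 2 * t w * z1)%C) z =
  fst z1 * dirD v r z + (2 * fst z1 * dirD v (fun w => Re (t w)) z
    + - 2 * snd z1 * dirD v (fun w => Im (t w)) z)).
{ intros v. rewrite <- L. apply Derive_ext. intros s. unfold Re, Im. simpl. ring. }
assert (EIm : forall v, dirD v
  (fun w => Im (RtoC (r w) * Cconj z1 + 2 * t w * z1)%C) z =
  - snd z1 * dirD v r z + (2 * snd z1 * dirD v (fun w => Re (t w)) z
    + 2 * fst z1 * dirD v (fun w => Im (t w)) z)).
{ intros v. rewrite <- L. apply Derive_ext. intros s. unfold Re, Im. simpl. ring. }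
assert (E0 : forall v, dirD v (fun w => Im (RtoC (r w))) z = 0).
{ intros v. exact (Derive_const 0 0). }
pose proof (fst_wirtb (fun w => RtoC (r w)) z) as A1.
pose proof (snd_wirtb (fun w => RtoC (r w)) z) as A2.
rewrite E0 in A1, A2.
change (fun w => Re (RtoC (r w))) with (fun w => r w) in A1, A2.
apply injective_projections; [rewrite fst_wirtb|rewrite snd_wirtb];
  rewrite ERe, EIm; clear ERe EIm;
  generalize (fst_wirtb t z) (snd_wirtb t z); revert A1 A2;
  generalize (wirtb (fun w => RtoC (r w)) z) (wirtb t z);
  intros A B A1 A2 B1 B2; simpl; rewrite A1, A2, B1, B2;
  change (dirD ?v (fun w => r w) z) with (dirD v r z); field.
Qed.

Section Levi.
Variables (F : C -> C -> R) (r : C -> R) (t : C -> C) (Rf R1 R2 : R -> R) (e : R).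
Hypothesis he : 0 < e.
Hypothesis hlevi : forall z1 z2, box e z1 -> box e z2 ->
  (dz1b (dz1 (embed F)) z1 z2 * dz2b (dz2 (embed F)) z1 z2
      - RtoC (Cmod (dz2b (dz1 (embed F)) z1 z2) ^ 2)%R)%C = 0.
Hypothesis hb : forall z1 z2, box e z1 -> box e z2 ->
  F z1 z2 = real_part_quadratic (r z2) (t z2) z1.
Hypothesis hr : forall z, box e z -> twice_diff_at r z.
Hypothesis ht1 : forall z, box e z -> twice_diff_at (fun w => Re (t w)) z.
Hypothesis ht2 : forall z, box e z -> twice_diff_at (fun w => Im (t w)) z.
Hypothesis hc : forall z, box e z -> wirtb t z = (RtoC (r z) ^ 2 / 2)%C.
Hypothesis hd : forall z, box e z -> r z = Rf (2 * fst z).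
Hypothesis hR1 : forall x, Rabs x < 2 * e -> is_derive Rf x (R1 x).
Hypothesis hR2 : forall x, Rabs x < 2 * e -> is_derive R1 x (R2 x).

Lemma dirD_r (v z : C) : box e z -> dirD v r z = 2 * fst v * R1 (2 * fst z).
Proof.
intros Hz. apply (dirD_fst v r Rf).
- now apply (box_locally e).
- now apply hR1, box_double.
Qed.

Lemma dirD2_r (v v' z : C) : box e z ->
  dirD v (dirD v' r) z = 4 * fst v * fst v' * R2 (2 * fst z).
Proof.
intros Hz.
rewrite (dirD_fst v _ (fun x => 2 * fst v' * R1 x) z (2 * fst v' * R2 (2 * fst z))).
- ring.
- apply (box_locally e); [|assumption]. intros w Hw. now apply dirD_r.
- apply (is_derive_scal R1). now apply hR2, box_double.
Qed.

Lemma dz1_F (z1 z2 : C) : box e z1 -> box e z2 ->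
  dz1 (embed F) z1 z2 = (RtoC (r z2) * Cconj z1 + 2 * t z2 * z1)%C.
Proof.
intros H1 H2. apply wirt_quadratic. apply (box_locally e); [|assumption].
intros w Hw. unfold embed. now rewrite hb.
Qed.

Lemma F_1_1b (z1 z2 : C) : box e z1 -> box e z2 ->
  dz1b (dz1 (embed F)) z1 z2 = RtoC (r z2).
Proof.
intros H1 H2. apply (wirtb_linear _ _ (t z2)). apply (box_locally e); [|assumption].
intros w Hw. now apply dz1_F.
Qed.

Lemma F_1_2b (z1 z2 : C) : box e z1 -> box e z2 ->
  dz2b (dz1 (embed F)) z1 z2 =
  (RtoC (R1 (2 * fst z2)) * Cconj z1 + RtoC (r z2 ^ 2) * z1)%C.
Proof.
intros H1 H2. unfold dz2b.
rewrite (wirtb_ext_loc _ (fun w => RtoC (r w) * Cconj z1 + 2 * t w * z1)%C).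
- rewrite wirtb_mixed; auto. rewrite (hc _ H2).
  replace (wirtb (fun w => RtoC (r w)) z2) with (RtoC (R1 (2 * fst z2))).
  + f_equal. replace (RtoC (r z2 ^ 2)) with (RtoC (r z2) ^ 2)%C
      by (simpl; rewrite !RtoC_mult; ring). field.
  + apply injective_projections; [rewrite fst_wirtb|rewrite snd_wirtb];
    change (dirD ?v (fun w => Re (RtoC (r w))) z2) with (dirD v r z2);
    rewrite !dirD_r by assumption; unfold dirD; simpl; rewrite Derive_const; field.
- apply (box_locally e); [|assumption]. intros w Hw. now apply dz1_F.
Qed.

(** On the two coordinate axes of the z1-plane F(z1, .) is a real combination
    of r and Re t only. *)
Lemma F_2_2b_axis (z1 z2 : C) (k s : R) : box e z1 -> box e z2 ->
  (forall z, box e z -> F z1 z = k * r z + s * Re (t z)) ->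
  fst (dz2b (dz2 (embed F)) z1 z2) = k * R2 (2 * fst z2) +
   s * (dirD (RtoC 1) (dirD (RtoC 1) (fun w => Re (t w))) z2 +
        dirD Ci (dirD Ci (fun w => Re (t w))) z2) / 4.
Proof.
intros H1 H2 HF.
assert (Er : locally (z2 : C_R_NormedModule) (twice_diff_at r)) by now apply (box_locally e).
assert (Et : locally (z2 : C_R_NormedModule) (twice_diff_at (fun w => Re (t w))))
 by now apply (box_locally e).
unfold dz2b, dz2.
rewrite (fst_wirtb_wirt_real _ (fun w => k * r w + s * Re (t w))).
- rewrite !(dirD2_lin _ _ r (fun w => Re (t w)) k s z2 Er Et), !dirD2_r by assumption.
  simpl. field.
- apply (box_locally e); [|assumption]. intros w Hw. unfold embed. now rewrite HF.
Qed.

(** The terms z1^2 and conj z1^2 of the Levi determinant are opposite at z1 = a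
    and z1 = i a.  Adding the determinants at these two points eliminates the
    second derivatives of t and leaves the coefficient of |z1|^2. *)
Lemma levi_ode (x : R) : Rabs x < 2 * e -> Rf x * R2 x = R1 x ^ 2 + Rf x ^ 4.
Proof.
intros Hx.
(* z2 is real with z2 + conj z2 = x. *)
set (z2 := (x / 2, 0) : C). set (a := e / 2).
assert (B2 : box e z2).
{ split; simpl; [|now rewrite Rabs_R0].
  unfold Rdiv. rewrite Rabs_mult, (Rabs_right (/ 2)); lra. }
assert (Ba : box e ((a, 0) : C)).
{ unfold a. split; simpl; [rewrite Rabs_right|rewrite Rabs_R0]; lra. }
assert (Bb : box e ((0, a) : C)).
{ unfold a. split; simpl; [rewrite Rabs_R0|rewrite Rabs_right]; lra. }
assert (Ex : 2 * fst z2 = x) by (simpl; field).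
assert (Er : r z2 = Rf x) by (rewrite hd, Ex; trivial).
pose proof (hlevi _ _ Ba B2) as La. pose proof (hlevi _ _ Bb B2) as Lb.
apply (f_equal fst) in La. apply (f_equal fst) in Lb.
rewrite F_1_1b, F_1_2b, Cmod_sqr, Ex, Er in La, Lb by assumption.
pose proof (F_2_2b_axis _ _ (a * a) (2 * (a * a)) Ba B2) as Da.
pose proof (F_2_2b_axis _ _ (a * a) (- 2 * (a * a)) Bb B2) as Db.
rewrite Ex in Da, Db.
assert (Ha : a <> 0) by (unfold a; lra).
set (T := dirD _ _ _ + _) in Da, Db.
assert (Fre : forall (p q : R) (X : C), fst (RtoC p * X - RtoC q)%C = p * fst X - q).
{ intros p q X. simpl. ring. }
rewrite Fre, Da in La.
2:{ intros z Hz. rewrite hb by assumption. unfold real_part_quadratic, Re. simpl. ring. }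
rewrite Fre, Db in Lb.
2:{ intros z Hz. rewrite hb by assumption. unfold real_part_quadratic, Re. simpl. ring. }
clear Da Db Fre. clearbody T. simpl in La, Lb.
apply (Rmult_eq_reg_l (2 * (a * a))); [|intros H; apply Ha; nra].
match type of La with ?A = _ => match type of Lb with ?B = _ =>
  assert (L : A + B = 0) by lra end end.
apply Rminus_diag_uniq. rewrite <- L. field.
Qed.
End Levi.

(** * The reciprocal of R solves a linear equation *)

Ltac ex_derive_from_hyp := match goal with
  | H : forall x, is_derive ?g x _ |- ex_derive (fun x => ?g x) ?t =>
      exact (ex_intro _ _ (H t))
  | H : forall x, Rabs x < ?d -> is_derive ?g x _, Ht : Rabs ?t < ?d
      |- ex_derive (fun x => ?g x) ?t => exact (ex_intro _ _ (H t Ht))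
  | H : is_derive ?g ?t _ |- ex_derive (fun x => ?g x) ?t => exact (ex_intro _ _ H)
  end.

Lemma const_of_derive_0 (f : R -> R) (d : R) :
  (forall x, Rabs x < d -> is_derive f x 0) ->
  forall x, Rabs x < d -> f x = f 0.
Proof.
intros Hf x Hx.
destruct (Rtotal_order x 0) as [H|[H|H]].
- apply (eq_is_derive (V := R_NormedModule)); [|assumption].
  intros t Ht. apply Hf. rewrite Rabs_left1 in Hx |- *; lra.
- now subst.
- symmetry. apply (eq_is_derive (V := R_NormedModule)); [|assumption].
  intros t Ht. apply Hf. rewrite Rabs_right in Hx |- *; lra.
Qed.

(** For y = 1/R the equation R R'' = R'^2 + R^4 becomes y'^2 - y y'' = 1.
    Differentiating (y'^2 - 1)/y^2 then gives 0; its constant value is c. *)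
Lemma reciprocal_ode (Rf R1 R2 : R -> R) (d : R) :
  (forall x, Rabs x < d -> 0 < Rf x) ->
  (forall x, Rabs x < d -> is_derive Rf x (R1 x)) ->
  (forall x, Rabs x < d -> is_derive R1 x (R2 x)) ->
  (forall x, Rabs x < d -> Rf x * R2 x = R1 x ^ 2 + Rf x ^ 4) ->
  exists (c : R) (y y' : R -> R),
  (forall x, Rabs x < d -> 0 < y x /\ Rf x = / y x) /\
  (forall x, Rabs x < d -> is_derive y x (y' x)) /\
  (forall x, Rabs x < d -> is_derive y' x (c * y x)) /\
  (forall x, Rabs x < d -> y' x ^ 2 - c * y x ^ 2 = 1).
Proof.
intros HR H1 H2 E.
set (y := fun x => / Rf x). set (y' := fun x => - R1 x / Rf x ^ 2).
set (y'' := fun x => - R2 x / Rf x ^ 2 + 2 * R1 x ^ 2 / Rf x ^ 3).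
set (cf := fun x => (y' x ^ 2 - 1) / y x ^ 2).
assert (Dy : forall x, Rabs x < d -> is_derive y x (y' x)).
{ intros x Hx. unfold y, y'. specialize (HR x Hx). specialize (H1 x Hx).
  auto_derive.
  - split; [ex_derive_from_hyp|]. split; [lra|easy].
  - rewrite (is_derive_unique (fun x : R => Rf x) _ _ H1). field. lra. }
assert (Dy' : forall x, Rabs x < d -> is_derive y' x (y'' x)).
{ intros x Hx. unfold y', y''. specialize (HR x Hx). specialize (H1 x Hx).
  specialize (H2 x Hx). auto_derive.
  - split; [ex_derive_from_hyp|]. split; [ex_derive_from_hyp|].
    split; [|easy]. apply Rgt_not_eq. apply Rmult_lt_0_compat; lra.
  - rewrite (is_derive_unique (fun x : R => Rf x) _ _ H1),
     (is_derive_unique (fun x : R => R1 x) _ _ H2). field. lra. }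
assert (Hy : forall x, Rabs x < d -> 0 < y x).
{ intros x Hx. apply Rinv_0_lt_compat, HR, Hx. }
assert (Ey : forall x, Rabs x < d -> y x * y'' x = y' x ^ 2 - 1).
{ intros x Hx. specialize (HR x Hx). specialize (E x Hx). unfold y, y', y''.
  replace (R2 x) with ((R1 x ^ 2 + Rf x ^ 4) / Rf x) by (rewrite <- E; field; lra).
  field. lra. }
assert (Hc : forall x, Rabs x < d -> cf x = cf 0).
{ apply const_of_derive_0. intros x Hx. specialize (Hy x Hx).
  unfold cf. auto_derive.
  - repeat split; try ex_derive_from_hyp.
    apply Rgt_not_eq. repeat apply Rmult_lt_0_compat; lra.
  - rewrite (is_derive_unique (fun x : R => y' x) _ _ (Dy' x Hx)),
     (is_derive_unique (fun x : R => y x) _ _ (Dy x Hx)).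
    replace (y'' x) with ((y' x ^ 2 - 1) / y x)
      by (rewrite <- (Ey x Hx); field; lra).
    field. lra. }
exists (cf 0), y, y'. split; [|split; [exact Dy|split]].
- intros x Hx. split; [now apply Hy|]. unfold y. now rewrite Rinv_inv.
- intros x Hx. replace (cf 0 * y x) with (y'' x); [now apply Dy'|].
  rewrite <- (Hc x Hx). unfold cf. rewrite <- (Ey x Hx). field.
  generalize (Hy x Hx); lra.
- intros x Hx. rewrite <- (Hc x Hx). unfold cf. field. generalize (Hy x Hx); lra.
Qed.

(** * Entire solutions of the linear equation *)

(** Trigonometric, affine or hyperbolic functions according to the sign of c. *)
Lemma cosine_sine_exist (c : R) : exists co si : R -> R,
  co 0 = 1 /\ si 0 = 0 /\
  (forall x, is_derive co x (c * si x)) /\ (forall x, is_derive si x (co x)).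
Proof.
destruct (Rtotal_order c 0) as [H|[H|H]].
- set (k := sqrt (- c)).
  assert (Hk : k * k = - c) by (apply sqrt_sqrt; lra).
  assert (Hk0 : 0 < k) by (apply sqrt_lt_R0; lra).
  exists (fun x => cos (k * x)), (fun x => sin (k * x) / k).
  rewrite !Rmult_0_r, cos_0, sin_0.
  split; [easy|]. split; [field; lra|]. split; intros x.
  + auto_derive; [easy|]. replace c with (- (k * k)) by lra. field. lra.
  + auto_derive; [lra|]. field. lra.
- subst c. exists (fun _ => 1), (fun x => x).
  split; [easy|]. split; [easy|]. split; intros x; auto_derive; trivial; ring.
- set (k := sqrt c).
  assert (Hk : k * k = c) by (apply sqrt_sqrt; lra).
  assert (Hk0 : 0 < k) by (apply sqrt_lt_R0; lra).
  exists (fun x => (exp (k * x) + exp (- (k * x))) / 2),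
         (fun x => (exp (k * x) - exp (- (k * x))) / (2 * k)).
  rewrite !Rmult_0_r, Ropp_0, exp_0.
  split; [field|]. split; [field; lra|]. split; intros x.
  + auto_derive; [easy|]. rewrite <- Hk. field. lra.
  + auto_derive; [lra|]. field. lra.
Qed.

Lemma cosine_sine_pythagoras (c : R) (co si : R -> R) :
  co 0 = 1 -> si 0 = 0 ->
  (forall x, is_derive co x (c * si x)) -> (forall x, is_derive si x (co x)) ->
  forall x, co x * co x - c * si x * si x = 1.
Proof.
intros co0 si0 Hco Hsi x.
set (f := fun x => co x * co x - c * si x * si x).
change (f x = 1).
rewrite (const_of_derive_0 f (Rabs x + 1)).
- unfold f. rewrite co0, si0. ring.
- intros t _. unfold f.
  auto_derive.
  + repeat split; ex_derive_from_hyp.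
  + rewrite (is_derive_unique (fun x : R => co x) _ _ (Hco t)),
        (is_derive_unique (fun x : R => si x) _ _ (Hsi t)). ring.
- lra.
Qed.

(** With co2 and si2 the solutions at the double argument, the quantities
    y co2 - y' si2 and y' co2 - c y si2, evaluated at 2x, are constant and can be
    solved for y and y'.  The double argument is z + conj z for x = Re z, so the
    values are polynomials in the data at Re z. *)
Lemma linear_ode_double (c : R) (co si y y' : R -> R) (d : R) :
  co 0 = 1 -> si 0 = 0 ->
  (forall x, is_derive co x (c * si x)) -> (forall x, is_derive si x (co x)) ->
  (forall x, Rabs x < d -> is_derive y x (y' x)) ->
  (forall x, Rabs x < d -> is_derive y' x (c * y x)) ->
  forall x, Rabs (2 * x) < d ->
  y (2 * x) = y 0 * (co x * co x + c * si x * si x) + y' 0 * (2 * si x * co x) /\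
  y' (2 * x) = y 0 * (c * (2 * si x * co x)) + y' 0 * (co x * co x + c * si x * si x).
Proof.
intros co0 si0 Hco Hsi Hy Hy' x Hx.
pose proof (cosine_sine_pythagoras c co si co0 si0 Hco Hsi) as P.
set (co2 := fun x => co x * co x + c * si x * si x).
set (si2 := fun x => 2 * si x * co x).
set (A := fun x => y (2 * x) * co2 x - y' (2 * x) * si2 x).
set (B := fun x => y' (2 * x) * co2 x - c * y (2 * x) * si2 x).
assert (Hb : forall t, Rabs t < d / 2 -> Rabs (2 * t) < d).
{ intros t Ht. rewrite Rabs_mult, (Rabs_right 2); lra. }
assert (Hx2 : Rabs x < d / 2).
{ rewrite Rabs_mult, (Rabs_right 2) in Hx; lra. }
assert (EA : A x = y 0).
{ rewrite (const_of_derive_0 A (d / 2)); [|intros t Ht|exact Hx2].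
  - unfold A, co2, si2. rewrite co0, si0, Rmult_0_r. ring.
  - apply Hb in Ht. unfold A, co2, si2. auto_derive.
    + repeat split; ex_derive_from_hyp.
    + rewrite (is_derive_unique (fun x : R => co x) _ _ (Hco t)),
        (is_derive_unique (fun x : R => si x) _ _ (Hsi t)).
      rewrite (is_derive_unique (fun x : R => y x) _ _ (Hy _ Ht)),
        (is_derive_unique (fun x : R => y' x) _ _ (Hy' _ Ht)). ring. }
assert (EB : B x = y' 0).
{ rewrite (const_of_derive_0 B (d / 2)); [|intros t Ht|exact Hx2].
  - unfold B, co2, si2. rewrite co0, si0, Rmult_0_r. ring.
  - apply Hb in Ht. unfold B, co2, si2. auto_derive.
    + repeat split; ex_derive_from_hyp.
    + rewrite (is_derive_unique (fun x : R => co x) _ _ (Hco t)),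
        (is_derive_unique (fun x : R => si x) _ _ (Hsi t)).
      rewrite (is_derive_unique (fun x : R => y x) _ _ (Hy _ Ht)),
        (is_derive_unique (fun x : R => y' x) _ _ (Hy' _ Ht)). ring. }
assert (P2 : co2 x * co2 x - c * si2 x * si2 x = 1).
{ replace (co2 x * co2 x - c * si2 x * si2 x)
    with ((co x * co x - c * si x * si x) * (co x * co x - c * si x * si x))
    by (unfold co2, si2; ring). rewrite P. ring. }
change (y (2 * x) = y 0 * co2 x + y' 0 * si2 x /\
  y' (2 * x) = y 0 * (c * si2 x) + y' 0 * co2 x).
rewrite <- EA, <- EB. unfold A, B. split.
- transitivity (y (2 * x) * (co2 x * co2 x - c * si2 x * si2 x)); [rewrite P2|]; ring.
- transitivity (y' (2 * x) * (co2 x * co2 x - c * si2 x * si2 x)); [rewrite P2|]; ring.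
Qed.

(** The addition formulas for sine and cosine at x + i y, where the solutions
    for -c describe the functions along the imaginary axis: S(iy) = i Sm(y) and
    K(iy) = Cm(y). *)
Definition csin (Sp Cp Sm Cm : R -> R) (w : C) : C :=
  (Sp (fst w) * Cm (snd w), Cp (fst w) * Sm (snd w)).
Definition ccos (c : R) (Sp Cp Sm Cm : R -> R) (w : C) : C :=
  (Cp (fst w) * Cm (snd w), c * (Sp (fst w) * Sm (snd w))).

Lemma hol_at_csin (c : R) (Sp Cp Sm Cm : R -> R) :
  (forall x, is_derive Cp x (c * Sp x)) -> (forall x, is_derive Sp x (Cp x)) ->
  (forall x, is_derive Cm x (- c * Sm x)) -> (forall x, is_derive Sm x (Cm x)) ->
  forall z, hol_at (csin Sp Cp Sm Cm) z (ccos c Sp Cp Sm Cm z) /\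
    hol_at (ccos c Sp Cp Sm Cm) z (RtoC c * csin Sp Cp Sm Cm z)%C.
Proof.
intros HCp HSp HCm HSm z.
pose proof (real_diff_fst _ z _ (HCp (fst z))) as D1.
pose proof (real_diff_fst _ z _ (HSp (fst z))) as D2.
pose proof (real_diff_snd _ z _ (HCm (snd z))) as D3.
pose proof (real_diff_snd _ z _ (HSm (snd z))) as D4.
split.
- pose proof (real_diff_mult _ _ _ _ _ _ _ D2 D3) as Du.
  pose proof (real_diff_mult _ _ _ _ _ _ _ D1 D4) as Dv.
  cbv beta in Du, Dv.
  replace (ccos c Sp Cp Sm Cm z) with
    ((Cp (fst z) * Cm (snd z), - - (c * (Sp (fst z) * Sm (snd z)))) : C)
    by (unfold ccos; now rewrite Ropp_involutive).
  apply (cauchy_riemann (fun w => Sp (fst w) * Cm (snd w))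
    (fun w => Cp (fst w) * Sm (snd w))).
  + apply (real_diff_eq _ _ _ _ _ _ Du); ring.
  + apply (real_diff_eq _ _ _ _ _ _ Dv); ring.
- pose proof (real_diff_mult _ _ _ _ _ _ _ D1 D3) as Du.
  pose proof (real_diff_lin _ _ _ _ _ _ _ c
     (real_diff_fst (fun _ => 0) z 0 (is_derive_const _ _))
     (real_diff_mult _ _ _ _ _ _ _ D2 D4)) as Dv.
  cbv beta in Du, Dv.
  replace (RtoC c * csin Sp Cp Sm Cm z)%C with
    ((c * (Sp (fst z) * Cm (snd z)), - - (c * (Cp (fst z) * Sm (snd z)))) : C)
    by (unfold csin; apply injective_projections; simpl; ring).
  apply (cauchy_riemann (fun w => Cp (fst w) * Cm (snd w))
    (fun w => c * (Sp (fst w) * Sm (snd w)))).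
  + apply (real_diff_eq _ _ _ _ _ _ Du); ring.
  + apply filterdiff_ext with (fun w : R * R => 0 + c * (Sp (fst w) * Sm (snd w))).
    { intros w. change (0 + c * (Sp (fst w) * Sm (snd w)) = c * (Sp (fst w) * Sm (snd w))). ring. }
    apply (real_diff_eq _ _ _ _ _ _ Dv); ring.
Qed.

(** * Maps fibered over the second coordinate *)

Local Open Scope C_scope.

Lemma filterdiff_C2_fst (p : C * C) :
  filterdiff (K := C_AbsRing) (U := C2) (V := C_NormedModule)
    (fun q : C * C => fst q) (locally (p : C2)) (fun q => fst q).
Proof.
apply (filterdiff_linear (U := C2) (V := C_NormedModule)).
exact (is_linear_fst (U := C_NormedModule) (V := C_NormedModule)).
Qed.

Lemma filterdiff_C2_snd (p : C * C) :
  filterdiff (K := C_AbsRing) (U := C2) (V := C_NormedModule)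
    (fun q : C * C => snd q) (locally (p : C2)) (fun q => snd q).
Proof.
apply (filterdiff_linear (U := C2) (V := C_NormedModule)).
exact (is_linear_snd (U := C_NormedModule) (V := C_NormedModule)).
Qed.

Lemma filterdiff_fiber_linear (k : C -> C) (p : C * C) (d : C) :
  hol_at k (snd p) d ->
  filterdiff (K := C_AbsRing) (U := C2) (V := C_NormedModule)
    (fun q : C * C => fst q * k (snd q)) (locally (p : C2))
    (fun v => fst v * k (snd p) + fst p * (snd v * d)).
Proof.
intros H.
apply (filterdiff_Cmult (U := C2) (fun q : C * C => fst q) (fun q : C * C => k (snd q)) p
  (fun v => fst v) (fun v => snd v * d)).
- apply filterdiff_C2_fst.
- apply (filterdiff_hol (U := C2) (fun q : C * C => snd q) k p _ _ (filterdiff_C2_snd p) H).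
Qed.

Lemma filterdiff_fiber_quadratic (k : C -> C) (p : C * C) (d : C) :
  hol_at k (snd p) d ->
  filterdiff (K := C_AbsRing) (U := C2) (V := C_NormedModule)
    (fun q : C * C => fst q * (fst q * k (snd q))) (locally (p : C2))
    (fun v => fst v * (fst p * k (snd p)) +
              fst p * (fst v * k (snd p) + fst p * (snd v * d))).
Proof.
intros H.
exact (filterdiff_Cmult (U := C2) (fun q : C * C => fst q)
  (fun q : C * C => fst q * k (snd q)) p _ _ (filterdiff_C2_fst p)
  (filterdiff_fiber_linear k p d H)).
Qed.

Lemma filterdiff_pair {U V W : NormedModule C_AbsRing} (f : U -> V) (g : U -> W) (x : U)
    (lf : U -> V) (lg : U -> W) :
  filterdiff f (locally x) lf -> filterdiff g (locally x) lg ->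
  filterdiff (V := prod_NormedModule C_AbsRing V W)
    (fun u => (f u, g u)) (locally x) (fun u => (lf u, lg u)).
Proof.
intros [Lf Hf] [Lg Hg]. split.
- apply (is_linear_prod (U := V) (V := W)); assumption.
- intros y Hy eps. specialize (Hf y Hy). specialize (Hg y Hy).
  generalize (filter_and _ _ (Hf (pos_div_2 eps)) (Hg (pos_div_2 eps))).
  apply filter_imp. intros u [H1 H2].
  change (pos (pos_div_2 eps)) with (eps / 2)%R in H1, H2.
  set (a := minus (minus (f u) _) _) in H1. set (b := minus (minus (g u) _) _) in H2.
  refine (Rle_trans _ (norm a + norm b) _ _ _); [|lra].
  change (sqrt (norm a ^ 2 + norm b ^ 2) <= norm a + norm b)%R.
  pose proof (norm_ge_0 a). pose proof (norm_ge_0 b).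
  apply Rsqr_incr_0_var; [|lra]. rewrite Rsqr_sqrt; unfold Rsqr; nra.
Qed.

Lemma locally_C2_box (e : R) (P : C * C -> Prop) : (0 < e)%R ->
  (forall p, box e (fst p) -> box e (snd p) -> P p) ->
  locally (origin2 : C2) P.
Proof.
intros He H. exists (mkposreal e He). intros p [[H1 H2] [H3 H4]].
change (Rabs (fst (fst p) - 0) < e)%R in H1.
change (Rabs (snd (fst p) - 0) < e)%R in H2.
change (Rabs (fst (snd p) - 0) < e)%R in H3.
change (Rabs (snd (snd p) - 0) < e)%R in H4.
rewrite Rminus_0_r in H1, H2, H3, H4. apply H; now split.
Qed.

Lemma locally_C3_box (e : R) (P : C * C * C -> Prop) : (0 < e)%R ->
  (forall z, box e (fst (fst z)) -> box e (snd (fst z)) -> P z) ->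
  locally (origin3 : C3) P.
Proof.
intros He H. exists (mkposreal e He). intros p [[[H1 H2] [H3 H4]] _].
change (Rabs (fst (fst (fst p)) - 0) < e)%R in H1.
change (Rabs (snd (fst (fst p)) - 0) < e)%R in H2.
change (Rabs (fst (snd (fst p)) - 0) < e)%R in H3.
change (Rabs (snd (snd (fst p)) - 0) < e)%R in H4.
rewrite Rminus_0_r in H1, H2, H3, H4. apply H; now split.
Qed.

Lemma box_0 (e : R) : (0 < e)%R -> box e (RtoC 0).
Proof. intros H. split; simpl; now rewrite Rabs_R0. Qed.

(** The terms containing derivatives of m and k carry a factor z1, which
    vanishes at the origin: the differential there is diagonal. *)
Lemma fibered_map_nondegenerate (m W k : C -> C) (dm dW dk : C) :
  hol_at m 0 dm -> hol_at W 0 dW -> hol_at k 0 dk -> m 0 <> 0 -> dW <> 0 ->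
  nondegenerate_at (rigid_map (fun z1 z2 => z1 * m z2) (fun z1 z2 => W z2)
    (fun z1 z2 => z1 * (z1 * k z2)) 1) origin3.
Proof.
intros Hm HW Hk m0 W0.
exists (fun v => ((fst (fst v) * m 0, snd (fst v) * dW), snd v)),
       (fun v => ((fst (fst v) * / m 0, snd (fst v) * / dW), snd v)).
split; [|split].
- assert (D1 : filterdiff (K := C_AbsRing) (U := C3) (V := C2)
    (fun z : C3 => fst z) (locally origin3) (fun z => fst z)).
  { apply (filterdiff_linear (U := C3) (V := C2)).
    exact (is_linear_fst (U := C2) (V := C_NormedModule)). }
  assert (D3 : filterdiff (K := C_AbsRing) (U := C3) (V := C_NormedModule)
    (fun z : C3 => snd z) (locally origin3) (fun z => snd z)).
  { apply (filterdiff_linear (U := C3) (V := C_NormedModule)).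
    exact (is_linear_snd (U := C2) (V := C_NormedModule)). }
  pose proof (filterdiff_comp' (U := C3) (V := C2) (W := C_NormedModule) _ _ origin3 _ _ D1
    (filterdiff_fiber_linear m origin2 dm Hm)) as Df.
  pose proof (filterdiff_comp' (U := C3) (V := C2) (W := C_NormedModule) _ _ origin3 _ _ D1
    (filterdiff_hol (U := C2) (fun q : C * C => snd q) W origin2 _ _
       (filterdiff_C2_snd origin2) HW)) as Dg.
  pose proof (filterdiff_comp' (U := C3) (V := C2) (W := C_NormedModule) _ _ origin3 _ _ D1
    (filterdiff_fiber_quadratic k origin2 dk Hk)) as Dh.
  pose proof (filterdiff_plus_fct (U := C3) (V := C_NormedModule) _ _ _ _ D3 Dh) as Ds.
  pose proof (filterdiff_pair (U := C3) (V := C2) (W := C_NormedModule) _ _ _ _ _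
    (filterdiff_pair (U := C3) (V := C_NormedModule) (W := C_NormedModule) _ _ _ _ _
      Df Dg) Ds) as DD.
  eapply filterdiff_ext_lin; [eapply filterdiff_ext; [|exact DD]|].
  + intros [[z1 z2] z3]. unfold rigid_map. simpl. f_equal.
    change (z3 + z1 * (z1 * k z2) = RtoC 1 * z3 + z1 * (z1 * k z2)). ring.
  + intros [[v1 v2] v3]. simpl.
    apply injective_projections; [apply injective_projections|]; simpl.
    * change (v1 * m 0 + 0 * (v2 * dm) = v1 * m 0). ring.
    * reflexivity.
    * change (v3 + (v1 * (0 * k 0) + 0 * (v1 * k 0 + 0 * (v2 * dk))) = v3). ring.
- intros [[v1 v2] v3]. simpl. f_equal. f_equal; field; assumption.
- intros [[v1 v2] v3]. simpl. f_equal. f_equal; field; assumption.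
Qed.

(** * The isometry onto the half-plane *)

(** Real and imaginary parts m1, m2 of M and n1, n2 of M' at a point, in terms of
    the real solutions there; Y and Y' are the double-argument values of y and
    y'.  All three equations lie in the ideal of the three quadratic relations. *)
Lemma isometry_polynomials (c y0 y1 sp cp sm cm : R) :
 (y1 * y1 - c * (y0 * y0) = 1 -> cp * cp - c * sp * sp = 1 ->
  cm * cm + c * sm * sm = 1 ->
  let m1 := y0 * (cp * cm) + (y1 - 1) * (sp * cm) in
  let m2 := y0 * (c * (sp * sm)) + (y1 - 1) * (cp * sm) in
  let n1 := y0 * (c * (sp * cm)) + (y1 - 1) * (cp * cm) in
  let n2 := y0 * (c * (cp * sm)) + (y1 - 1) * (c * (sp * sm)) in
  let Y := y0 * (cp * cp + c * sp * sp) + y1 * (2 * sp * cp) in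
  let Y' := y0 * (c * (2 * sp * cp)) + y1 * (cp * cp + c * sp * sp) in
  m1 * m1 + m2 * m2 + 2 * (m1 * (sp * cm) + m2 * (cp * sm)) = y0 * Y /\
  m1 = m1 * Y' - n1 * Y /\ - m2 = m2 * Y' - n2 * Y)%R.
Proof.
intros H0 Hp Hm m1 m2 n1 n2 Y Y'; subst m1 m2 n1 n2 Y Y'.
split; [|split]; nsatz.
Qed.

(** The first identity says that W = S/M pulls the half-plane metric
    |dW|/(W + conj W + 1) back to |dz|/Y, the second that the pulled back tube has
    the square coefficient -Y'/(2Y) + M'/(2M); N stands for M'. *)
Lemma isometry_identities (c y0 y1 sp cp sm cm : R) :
  (y1 ^ 2 - c * y0 ^ 2 = 1)%R -> (cp * cp - c * sp * sp = 1)%R ->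
  (cm * cm - - c * sm * sm = 1)%R ->
  let S : C := ((sp * cm)%R, (cp * sm)%R) in
  let K : C := ((cp * cm)%R, (c * (sp * sm))%R) in
  let M := RtoC y0 * K + RtoC (y1 - 1) * S in
  let N := RtoC y0 * (RtoC c * S) + RtoC (y1 - 1) * K in
  let Y := (y0 * (cp * cp + c * sp * sp) + y1 * (2 * sp * cp))%R in
  let Y' := (y0 * (c * (2 * sp * cp)) + y1 * (cp * cp + c * sp * sp))%R in
  M * Cconj S + Cconj M * S + M * Cconj M = RtoC (y0 * Y)%R /\
  Cconj M = M * RtoC Y' - N * RtoC Y.
Proof.
intros H0 Hp Hm.
destruct (isometry_polynomials c y0 y1 sp cp sm cm) as (E1 & E2 & E3);
  [rewrite <- H0; ring|exact Hp|rewrite <- Hm; ring|].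
intros S K M N Y Y'. fold Y in E1, E2, E3. fold Y' in E2, E3.
split; apply injective_projections; unfold M, N, S, K.
- change (fst (RtoC (y0 * Y))) with (y0 * Y)%R. rewrite <- E1. simpl. ring.
- simpl. ring.
- simpl. refine (eq_trans _ (eq_trans E2 _)); ring.
- simpl. refine (eq_trans _ (eq_trans E3 _)); ring.
Qed.

(** The conjugates zb, tb, Mb, Nb, Sb are independent variables here, as in a
    polarization; -q is the conjugate of the imaginary number q.  The first
    relation evaluates the denominator as y0 y/(M Mb), the other two eliminate N
    and Nb. *)
Lemma tube_pullback (q zz zb t tb M Mb N Nb S Sb y y' y0 : C) :
  M <> 0 -> Mb <> 0 -> y <> 0 -> y0 <> 0 -> q * q = - (y0 / 2) ->
  M * Sb + Mb * S + M * Mb = y0 * y ->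
  Mb = M * y' - N * y -> M = Mb * y' - Nb * y ->
  (zz * (q * / M) + zb * (- q * / Mb)) ^ 2 / (S * / M + Sb * / Mb + 1) =
  / y * (zz * zb) + t * zz ^ 2 + tb * zb ^ 2 +
  (zz * (zz * (N * / M - 2 * (t + y' / (2 * y)))) +
   zb * (zb * (Nb * / Mb - 2 * (tb + y' / (2 * y))))) / 2.
Proof.
intros HM HMb Hy Hy0 Hq E2 E3 E4.
replace (S * / M + Sb * / Mb + 1) with (y0 * y / (M * Mb))
  by (rewrite <- E2; field; auto).
replace ((zz * (q * / M) + zb * (- q * / Mb)) ^ 2)
  with ((q * q) * (zz / M - zb / Mb) ^ 2) by (simpl; field; auto).
rewrite Hq.
replace N with ((M * y' - Mb) / y) by (rewrite E3; field; auto).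
replace Nb with ((Mb * y' - M) / y) by (rewrite E4; field; auto).
field. auto.
Qed.

Lemma Re_plus_conj (a b : C) :
  RtoC (Re (RtoC 1 * a + b)) = RtoC (Re a) + (b + Cconj b) / 2.
Proof. apply injective_projections; unfold Re; simpl; field. Qed.

Lemma equivalent_to_tube (F : C -> C -> R) (t : C -> C) (c e : R) (y y' : R -> R) :
  (0 < e)%R ->
  (forall z1 z2, box e z1 -> box e z2 ->
     F z1 z2 = real_part_quadratic (/ y (2 * fst z2))%R (t z2) z1) ->
  (forall x, Rabs x < 2 * e -> 0 < y x)%R ->
  (forall x, (Rabs x < 2 * e)%R -> is_derive y x (y' x)) ->
  (forall x, (Rabs x < 2 * e)%R -> is_derive y' x (c * y x)%R) ->
  (y' 0 ^ 2 - c * y 0 ^ 2 = 1)%R ->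
  (forall z, box e z -> exists d,
     hol_at (fun w => t w + RtoC (y' (2 * fst w) / (2 * y (2 * fst w)))%R) z d) ->
  rigidly_equivalent (embed F) (model_i 1).
Proof.
intros He HF Hpos Hy Hy' H0 Htau.
destruct (cosine_sine_exist c) as (Cp & Sp & Cp0 & Sp0 & HCp & HSp).
destruct (cosine_sine_exist (- c)%R) as (Cm & Sm & Cm0 & Sm0 & HCm & HSm).
set (S := csin Sp Cp Sm Cm). set (K := ccos c Sp Cp Sm Cm).
set (y0 := y 0) in *. set (y1 := y' 0) in *.
assert (P0 : (0 < y0)%R) by (apply Hpos; rewrite Rabs_R0; lra).
set (M := fun w => RtoC y0 * K w + RtoC (y1 - 1) * S w).
set (N := fun w => RtoC y0 * (RtoC c * S w) + RtoC (y1 - 1) * K w).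
assert (HM : forall z, hol_at M z (N z)).
{ intros z. destruct (hol_at_csin c Sp Cp Sm Cm HCp HSp HCm HSm z) as [DS DK].
  apply hol_at_plus; apply hol_at_scal; assumption. }
assert (HS : forall z, hol_at S z (K z)).
{ intros z. apply (hol_at_csin c Sp Cp Sm Cm HCp HSp HCm HSm z). }
assert (HN : forall z, hol_at N z (RtoC y0 * (RtoC c * K z) + RtoC (y1 - 1) * (RtoC c * S z))).
{ intros z. destruct (hol_at_csin c Sp Cp Sm Cm HCp HSp HCm HSm z) as [DS DK].
  apply hol_at_plus; apply hol_at_scal; [apply hol_at_scal|]; assumption. }
assert (Hid : forall z, box e z ->
  M z * Cconj (S z) + Cconj (M z) * S z + M z * Cconj (M z)
    = RtoC (y0 * y (2 * fst z))%R /\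
  Cconj (M z) = M z * RtoC (y' (2 * fst z)%R) - N z * RtoC (y (2 * fst z)%R)).
{ intros z Hz. apply box_double in Hz.
  destruct (linear_ode_double c Cp Sp y y' (2 * e) Cp0 Sp0 HCp HSp Hy Hy' _ Hz)
    as [-> ->].
  apply (isometry_identities c y0 y1 (Sp (fst z)) (Cp (fst z)) (Sm (snd z)) (Cm (snd z)) H0).
  - now apply cosine_sine_pythagoras.
  - now apply cosine_sine_pythagoras. }
assert (Hy2 : forall z, box e z -> (0 < y (2 * fst z))%R).
{ intros z Hz. now apply Hpos, box_double. }
(* The metric identity has a positive right-hand side, and its left-hand side
   vanishes with M. *)
assert (HM0 : forall z, box e z -> M z <> 0).
{ intros z Hz E. destruct (Hid z Hz) as [E2 _]. rewrite E in E2.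
  apply (f_equal fst) in E2. simpl in E2. specialize (Hy2 z Hz).
  assert (0 < y0 * y (2 * fst z))%R by now apply Rmult_lt_0_compat. lra. }
(* The mixed term needs |q|^2 = y0/2; q is imaginary because the square
   coefficient of the tube has to be -y'/(2y), not y'/(2y). *)
set (a := sqrt (y0 / 2)).
assert (Ha : (a * a = y0 / 2)%R) by (apply sqrt_sqrt; lra).
assert (Ha0 : (0 < a)%R) by (apply sqrt_lt_R0; lra).
set (q := (0%R, a) : C).
assert (Hq : q * q = - (RtoC y0 / 2)).
{ apply injective_projections; simpl; [|field].
  transitivity (- (a * a))%R; [ring|]. rewrite Ha. field. }
set (m := fun w => q * / M w).
set (W := fun w => S w * / M w).
set (tau := fun w => t w + RtoC (y' (2 * fst w) / (2 * y (2 * fst w)))%R).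
set (k := fun w => N w * / M w - 2 * tau w).
assert (Hm : forall z, box e z -> exists d, hol_at m z d).
{ intros z Hz. eexists. apply (hol_at_scal (fun w => / M w)), (hol_at_inv M);
    [now apply HM0|apply HM]. }
assert (HW : forall z, box e z ->
  hol_at W z (K z * / M z + S z * (N z * - / (M z * M z)))).
{ intros z Hz. apply (hol_at_mult S (fun w => / M w)); [apply HS|].
  apply (hol_at_inv M); [now apply HM0|apply HM]. }
assert (Hk : forall z, box e z -> exists d, hol_at k z d).
{ intros z Hz. destruct (Htau z Hz) as [d Hd]. eexists.
  unfold k.
  apply (filterdiff_ext (K := C_AbsRing) (U := C_NormedModule) (V := C_NormedModule)
    (fun w => N w * / M w + - (2) * tau w)).
  - intros w. change (N w * / M w + - (2) * tau w = N w * / M w - 2 * tau w). ring.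
  - apply (hol_at_plus (fun w => N w * / M w) (fun w => - (2) * tau w));
      [apply (hol_at_mult N (fun w => / M w)); [apply HN|]|].
    + apply (hol_at_inv M); [now apply HM0|apply HM].
    + apply (hol_at_scal tau). exact Hd. }
pose proof (box_0 e He) as B0.
assert (S00 : S 0 = 0).
{ unfold S, csin. simpl. rewrite Sp0, Sm0. apply injective_projections; simpl; ring. }
assert (K00 : K 0 = 1).
{ unfold K, ccos. simpl. rewrite Sp0, Sm0, Cp0, Cm0.
  apply injective_projections; simpl; ring. }
assert (Hy0 : RtoC y0 <> 0) by (intros E; apply RtoC_inj in E; lra).
assert (M00 : M 0 = RtoC y0) by (unfold M; rewrite S00, K00; ring).
exists (fun z1 z2 => z1 * m z2), (fun _ z2 => W z2), (fun z1 z2 => z1 * (z1 * k z2)), 1%R.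
split; [|split; [|split; [|split; [|split; [|split; [|split; [|split]]]]]]].
- apply (locally_C2_box e); [exact He|]. intros p _ Hp.
  destruct (Hm _ Hp) as [d Hd]. eexists. exact (filterdiff_fiber_linear m p d Hd).
- apply (locally_C2_box e); [exact He|]. intros p _ Hp. eexists.
  exact (filterdiff_hol (U := C2) (fun q : C * C => snd q) W p _ _
       (filterdiff_C2_snd p) (HW _ Hp)).
- apply (locally_C2_box e); [exact He|]. intros p _ Hp.
  destruct (Hk _ Hp) as [d Hd]. eexists. exact (filterdiff_fiber_quadratic k p d Hd).
- ring.
- unfold W. rewrite S00. ring.
- ring.
- lra.
- destruct (Hm _ B0) as [dm Hdm], (Hk _ B0) as [dk Hdk].
  apply (fibered_map_nondegenerate m W k dm _ dk Hdm (HW _ B0) Hdk).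
  + unfold m. rewrite M00. apply Cmult_neq_0.
    * intros E. apply (f_equal snd) in E. simpl in E. lra.
    * intros E. apply (f_equal (fun u => RtoC y0 * u)) in E.
      rewrite Cinv_r, Cmult_0_r in E by assumption.
      apply RtoC_inj in E. lra.
  + rewrite S00, K00, M00. intros E. apply (f_equal (fun u => RtoC y0 * u)) in E.
    replace (RtoC y0 * (1 * / RtoC y0 + 0 * (N 0 * - / (RtoC y0 * RtoC y0)))) with (RtoC 1) in E
      by (field; assumption).
    rewrite Cmult_0_r in E. apply RtoC_inj in E. lra.
- apply (locally_C3_box e); [exact He|]. intros [[z1 z2] z3] B1 B2. simpl in B1, B2.
  unfold rigid_hypersurface, rigid_map. simpl fst. simpl snd. intros Hz.
  apply RtoC_inj in Hz.
  destruct (Hid z2 B2) as [E2 E3].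
  pose proof (f_equal Cconj E3) as E4.
  specialize (Hy2 z2 B2).
  assert (Hyc : RtoC (y (2 * fst z2)%R) <> 0) by (intros E; apply RtoC_inj in E; lra).
  assert (HMb : Cconj (M z2) <> 0).
  { intros E. apply (HM0 z2 B2). rewrite <- (Cconj_conj (M z2)), E.
    apply injective_projections; simpl; ring. }
  assert (Cr : forall x : R, Cconj (RtoC x) = RtoC x).
  { intros x. apply injective_projections; simpl; ring. }
  rewrite Cminus_conj, !Cmult_conj, !Cr, Cconj_conj in E4.
  rewrite RtoC_mult in E2.
  pose proof (tube_pullback q z1 (Cconj z1) (t z2) (Cconj (t z2)) _ _ _ _ _ _ _ _ _
    (HM0 z2 B2) HMb Hyc Hy0 Hq E2 E3 E4) as T.
  assert (Hqb : Cconj q = - q) by (apply injective_projections; simpl; ring).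
  set (hh := z1 * (z1 * (N z2 * / M z2 -
    2 * (t z2 + RtoC (y' (2 * fst z2)%R) / (2 * RtoC (y (2 * fst z2)%R)))))).
  assert (Ek : z1 * (z1 * k z2) = hh).
  { unfold hh, k, tau. rewrite RtoC_div, RtoC_mult by lra. reflexivity. }
  assert (Ehb : Cconj hh = Cconj z1 * (Cconj z1 * (Cconj (N z2) * / Cconj (M z2) -
    2 * (Cconj (t z2) + RtoC (y' (2 * fst z2)%R) / (2 * RtoC (y (2 * fst z2)%R)))))).
  { unfold hh, Cdiv. rewrite <- RtoC_mult, <- RtoC_inv by lra.
    now rewrite !Cmult_conj, Cminus_conj, !Cmult_conj, Cplus_conj, !Cmult_conj, !Cr,
      Cinv_conj by auto. }
  rewrite Ek.
  rewrite Re_plus_conj, Hz, (HF z1 z2 B1 B2), Ehb.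
  unfold model_i, m, W.
  rewrite !Cmult_conj, !Cinv_conj, Hqb by auto.
  refine (eq_trans _ (eq_sym T)). unfold hh. f_equal.
  unfold real_part_quadratic. rewrite <- RtoC_inv by lra.
  apply injective_projections; simpl; ring.
Qed.

(** * The coefficient of the square term *)

(** By (y'/y)' = -1/y^2 = -R^2, the \bar 2-derivative of y'/(2y) at z + conj z is
    -r^2/2, which cancels that of t. *)
Lemma hol_at_completed_coefficient (t : C -> C) (r : C -> R) (c e : R) (y y' : R -> R) :
  (forall z, box e z -> twice_diff_at (fun w => Re (t w)) z) ->
  (forall z, box e z -> twice_diff_at (fun w => Im (t w)) z) ->
  (forall z, box e z -> wirtb t z = RtoC (/ y (2 * fst z)%R) ^ 2 / 2) ->
  (forall x, Rabs x < 2 * e -> 0 < y x)%R ->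
  (forall x, (Rabs x < 2 * e)%R -> is_derive y x (y' x)) ->
  (forall x, (Rabs x < 2 * e)%R -> is_derive y' x (c * y x)%R) ->
  (forall x, (Rabs x < 2 * e)%R -> y' x ^ 2 - c * y x ^ 2 = 1)%R ->
  forall z, box e z -> exists d,
     hol_at (fun w => t w + RtoC (y' (2 * fst w) / (2 * y (2 * fst w)))%R) z d.
Proof.
intros H1 H2 Hc Hpos Hy Hy' HE z Hz.
pose proof (twice_diff_real_diff _ z (box_locally e _ z H1 Hz)) as D1.
pose proof (twice_diff_real_diff _ z (box_locally e _ z H2 Hz)) as D2.
pose proof (box_double e z Hz) as Bz. simpl in Bz.
assert (D3 : real_diff (fun w => y' (2 * fst w) / (2 * y (2 * fst w)))%R z
  (- (/ y (2 * fst z)%R) ^ 2) 0).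
{ apply (real_diff_fst (fun x => y' (2 * x) / (2 * y (2 * x)))%R).
  specialize (Hpos _ Bz). specialize (Hy _ Bz). specialize (Hy' _ Bz). specialize (HE _ Bz).
  auto_derive.
  - split; [ex_derive_from_hyp|]. split; [ex_derive_from_hyp|]. split; [|easy]. lra.
  - rewrite (is_derive_unique (fun x : R => y x) _ _ Hy),
      (is_derive_unique (fun x : R => y' x) _ _ Hy').
    replace (- (/ y (2 * fst z)) ^ 2)%R with
     (- (y' (2 * fst z) ^ 2 - c * y (2 * fst z) ^ 2) * (/ y (2 * fst z)) ^ 2)%R
     by (rewrite HE; ring).
    field. lra. }
pose proof (real_diff_lin _ _ _ _ _ _ _ 1 D1 D3) as D4.
pose proof (f_equal fst (Hc z Hz)) as C1. pose proof (f_equal snd (Hc z Hz)) as C2.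
rewrite fst_wirtb in C1. rewrite snd_wirtb in C2.
set (a1 := dirD _ _ _) in *. set (a2 := dirD _ _ _) in *.
eexists.
apply (filterdiff_ext (K := C_AbsRing) (U := C_NormedModule) (V := C_NormedModule)
  (fun w : C => ((Re (t w) + 1 * (y' (2 * fst w) / (2 * y (2 * fst w))))%R, Im (t w)) : C)).
- intros w. apply injective_projections; unfold Re, Im; simpl; ring.
- refine (cauchy_riemann _ _ z _ _ D4 _).
  refine (real_diff_eq _ _ _ _ _ _ D2 _ _).
  + simpl in C2. lra.
  + simpl in C1. lra.
Qed.

(** * The equivalence theorem *)

Theorem theorem5p5
  (F : C -> C -> R) (r : C -> R) (t : C -> C) (Rf : R -> R)
  (hF : graphing_germ F)
  (hC21 : in_class_C21 F)
  (ha : near0 (fun z1 z2 =>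
     dz1 (Sfun (embed F)) z1 z2 = 0 /\ dz1b (Sfun (embed F)) z1 z2 = 0))
  (hr : smooth_near (V := C_R_NormedModule) r (RtoC 0))
  (ht_re : smooth_near (V := C_R_NormedModule) (fun z => Re (t z)) (RtoC 0))
  (ht_im : smooth_near (V := C_R_NormedModule) (fun z => Im (t z)) (RtoC 0))
  (hb : near0 (fun z1 z2 =>
     RtoC (F z1 z2) =
       RtoC (r z2) * RtoC (Cmod z1 ^ 2)%R
       + t z2 * z1 ^ 2 + Cconj (t z2) * Cconj z1 ^ 2))
  (hc : locally (RtoC 0 : C_R_NormedModule) (fun z => wirtb t z = RtoC (r z) ^ 2 / 2))
  (hRf : smooth_near (V := R_NormedModule) Rf 0%R)
  (hRf_pos : locally 0%R (fun x => (0 < Rf x)%R))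
  (hd : locally (RtoC 0 : C_R_NormedModule) (fun z => r z = Rf (Re (z + Cconj z)))) :
  (exists D : R, (0 < D)%R /\ rigidly_equivalent (embed F) (model_i D)) \/
  (exists D : R, (0 < D < 1)%R /\ rigidly_equivalent (embed F) (model_ii D)) \/
  (exists D : R, (0 < D < PI / 2)%R /\ rigidly_equivalent (embed F) (model_iii D)).
Proof.
left. exists 1%R. split; [lra|].
unfold in_class_C21 in hC21.
destruct (near0_box _ (near0_and _ _ hC21 hb)) as (e1 & He1 & A1).
destruct (locally_box _ (filter_and _ _ (smooth_near_twice_diff _ _ hr)
  (filter_and _ _ (smooth_near_twice_diff _ _ ht_re)
  (filter_and _ _ (smooth_near_twice_diff _ _ ht_im) (filter_and _ _ hc hd)))))
  as (e2 & He2 & A2).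
destruct (filter_and _ _ (smooth_near_R_twice _ _ hRf) hRf_pos) as (e3 & A3).
set (e := Rmin (Rmin e1 e2) (e3 / 2)).
assert (He : (0 < e)%R).
{ repeat apply Rmin_pos; trivial. generalize (cond_pos e3); lra. }
assert (L1 : (e <= e1)%R) by (eapply Rle_trans; apply Rmin_l).
assert (L2 : (e <= e2)%R) by (eapply Rle_trans; [apply Rmin_l|apply Rmin_r]).
assert (L3 : (2 * e <= e3)%R) by (generalize (Rmin_r (Rmin e1 e2) (e3 / 2)); fold e; lra).
assert (B3 : forall x, (Rabs x < 2 * e)%R ->
  (is_derive Rf x (Derive Rf x) /\ is_derive (Derive Rf) x (Derive (Derive Rf) x)) /\
  (0 < Rf x)%R).
{ intros x Hx. apply A3. change (Rabs (x - 0) < e3)%R. rewrite Rminus_0_r. lra. }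
assert (Hd : forall z, box e z -> r z = Rf (2 * fst z)%R).
{ intros z Hz. destruct (A2 z (box_le _ _ _ L2 Hz)) as (_ & _ & _ & _ & ->).
  f_equal. unfold Re. simpl. ring. }
assert (HFq : forall z1 z2, box e z1 -> box e z2 ->
  F z1 z2 = real_part_quadratic (r z2) (t z2) z1).
{ intros z1 z2 B1 B2.
  destruct (A1 z1 z2 (box_le _ _ _ L1 B1) (box_le _ _ _ L1 B2)) as [_ E].
  now apply quadratic_real_form. }
assert (Hode : forall x, (Rabs x < 2 * e)%R ->
  (Rf x * Derive (Derive Rf) x = Derive Rf x ^ 2 + Rf x ^ 4)%R).
{ apply (levi_ode F r t); trivial.
  - intros z1 z2 B1 B2.
    destruct (A1 z1 z2 (box_le _ _ _ L1 B1) (box_le _ _ _ L1 B2)) as [[_ [E _]] _].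
    exact E.
  - intros z Hz. apply (A2 z (box_le _ _ _ L2 Hz)).
  - intros z Hz. apply (A2 z (box_le _ _ _ L2 Hz)).
  - intros z Hz. apply (A2 z (box_le _ _ _ L2 Hz)).
  - intros z Hz. apply (A2 z (box_le _ _ _ L2 Hz)).
  - intros x Hx. apply (B3 x Hx).
  - intros x Hx. apply (B3 x Hx). }
destruct (reciprocal_ode Rf (Derive Rf) (Derive (Derive Rf)) (2 * e))
  as (c & y & y' & Hy & Dy & Dy' & Hcy); trivial.
{ intros x Hx. apply (B3 x Hx). }
{ intros x Hx. apply (B3 x Hx). }
{ intros x Hx. apply (B3 x Hx). }
assert (Hry : forall z, box e z -> r z = (/ y (2 * fst z))%R).
{ intros z Hz. rewrite Hd by assumption. now apply Hy, box_double. }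
apply (equivalent_to_tube F t c e y y'); trivial.
- intros z1 z2 B1 B2. rewrite HFq, Hry; trivial.
- intros x Hx. apply (Hy x Hx).
- apply Hcy. rewrite Rabs_R0. lra.
- apply (hol_at_completed_coefficient t r c e y y'); trivial.
  + intros z Hz. apply (A2 z (box_le _ _ _ L2 Hz)).
  + intros z Hz. apply (A2 z (box_le _ _ _ L2 Hz)).
  + intros z Hz. rewrite <- Hry by assumption. apply (A2 z (box_le _ _ _ L2 Hz)).
  + intros x Hx. apply (Hy x Hx).
Qed.
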